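(* Let $k\ge2$ and $d\ge1$ be integers. Let $\mathcal{A}$ be a trim Büchi automaton with alphabet $\{0,\dots,k-1\}^d$, set of states $Q$ and set of accept states $F$, and let $X\subseteq[0,1]^d$ be the set of elements of $[0,1]^d$ that have a base-$k$ representation that $\mathcal{A}$ accepts. Then: (i) $d_H(X)=\frac{1}{\log k}\max_{q\in F}h(C_q(\mathcal{A}))$; (ii) $d_B(X)=\frac{1}{\log k}\max_{q\in Q}h(C_q(\mathcal{A}))$, where the maxima are taken over those states $q$ for which $C_q(\mathcal{A})$ is infinite.
   Context: A Büchi automaton is a 5-tuple $\mathcal{A}=(Q,\Sigma,\delta,S,F)$ with $Q$ a finite set of states, $\Sigma$ a finite alphabet, $\delta:Q\times\Sigma\to\mathcal{P}(Q)$ the transition function, $S\subseteq Q$ nonempty (start states), $F\subseteq Q$ (accept states). A run of $w=w_1w_2\cdots\in\Sigma^\omega$ is a sequence $q_0,q_1,\dots$ of states with $q_0\in S$ and $q_i\in\delta(q_{i-1},w_i)$ for $i\ge1$; it is accepting if $q_i\in F$ for infinitely many $i$. $\mathcal{A}$ accepts $w$ if some run of $w$ is accepting. $\mathcal{A}$ carries a digraph structure with vertex set $Q$ and an edge $(q,q')$ whenever $q'\in\delta(q,\sigma)$ for some $\sigma\in\Sigma$. $\mathcal{A}$ is trim if for each $q\in Q$ there is a path (possibly of length zero) from a start state to $q$ and a path of nonzero length from $q$ to an accept state. Write $[k]=\{0,\dots,k-1\}$. For $w=w_0w_1\cdots\in[k]^\omega$, $\nu_k(w)=\sum_{i\ge0}w_i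 k^{-(i+1)}$; on $([k]^d)^\omega$, $\nu_k$ is applied coordinatewise. A string $w\in([k]^d)^\omega$ is a base-$k$ representation of $x\in[0,1]^d$ if $\nu_k(w)=x$. For a state $q$, the cycle language $C_q(\mathcal{A})\subseteq\Sigma^*$ is the set of finite strings $w=w_1\cdots w_m$ for which there are states $q=q_0,q_1,\dots,q_m=q$ with $q_i\in\delta(q_{i-1},w_i)$ for $1\le i\le m$ (the empty string is included). For an infinite language $L\subseteq\Sigma^*$, $|L|_m$ is the number of strings of length $m$ in $L$ and the entropy is $h(L)=\limsup_{m\to\infty}\frac{\log|L|_m}{m}$. $d_H$ is Hausdorff dimension and $d_B$ is box-counting (Minkowski) dimension; (ii) includes the assertion that $d_B(X)$ exists. *)

(* Defs.v *)
From HB Require Import structures.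
From mathcomp Require Import all_boot all_order all_algebra.
From mathcomp Require Import all_classical all_reals all_analysis.
Import Order.TTheory GRing.Theory Num.Theory.
Import numFieldNormedType.Exports.

Set Implicit Arguments.
Unset Strict Implicit.
Unset Printing Implicit Defensive.

Local Open Scope classical_set_scope.
Local Open Scope ring_scope.

Record buchi (Sigma : finType) := Buchi {
  state : finType;
  trans : state -> Sigma -> {set state};
  start : {set state};
  accept : {set state};
  start_neq0 : start != finset.set0
}.

Section Automata.
Variables (Sigma : finType) (A : buchi Sigma).

(* Infinite words are indexed from 0: the letter w_{i+1} of w_1 w_2 ... is
   [w i], so that it leads from [r i] to [r i.+1]. *)
Definition is_run (w : nat -> Sigma) (r : nat -> state A) : Prop :=
  r 0%N \in start A /\ forall i, r i.+1 \in trans (r i) (w i).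

Definition accepting (r : nat -> state A) : Prop :=
  infinite_set [set i | r i \in accept A].

Definition accepts (w : nat -> Sigma) : Prop :=
  exists2 r, is_run w r & accepting r.

Definition edge : rel (state A) :=
  [rel q q' | [exists a, q' \in trans q a]].

(* [path edge q p] says that q :: p is a walk, of length [size p]. *)
Definition trim : Prop := forall q : state A,
  (exists s p, [/\ s \in start A, path edge s p & last s p = q]) /\
  (exists p, [/\ p != [::], path edge q p & last q p \in accept A]).

Definition cycle_lang (q : state A) : set (seq Sigma) :=
  [set w | exists r : nat -> state A,
    [/\ r 0%N = q, r (size w) = q &
        forall i : 'I_(size w),
          r i.+1 \in trans (r i) (tnth (in_tuple w) i)]].

End Automata.

Definition lang_count (Sigma : finType) (L : set (seq Sigma)) (m : nat) : nat :=
  #|[pred t : m.-tuple Sigma | `[< L (tval t) >]]|.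

Section Entropy.
Variable R : realType.
Local Open Scope ereal_scope.

(* [lne 0 = -oo]: lengths m for which L has no word do not contribute to the
   upper limit. *)
Definition entropy (Sigma : finType) (L : set (seq Sigma)) : \bar R :=
  limn_esup (fun m : nat =>
    lne (lang_count L m)%:R%:E * (m%:R^-1)%:E : \bar R).

(* The value -oo of the maximum over an empty set of states does not occur for
   a trim automaton, which always has an accept state lying on a cycle. *)
Definition max_entropy (Sigma : finType) (A : buchi Sigma)
    (P : {set state A}) : \bar R :=
  \big[maxe/-oo]_(q in P | `[< infinite_set (cycle_lang q) >])
    entropy (cycle_lang q).

End Entropy.

Section Representation.
Variables (R : realType) (k d : nat).

Definition nu1 (w : nat -> 'I_k) : R :=
  limn (series (fun i : nat => (w i)%:R / k%:R ^+ i.+1 : R)).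

Definition nu (w : nat -> 'rV['I_k]_d) : 'rV[R]_d :=
  \row_(j < d) nu1 (fun i => w i ord0 j).

Definition unit_cube : set 'rV[R]_d :=
  [set x | forall j, 0 <= x ord0 j <= 1].

Definition recognized (A : buchi 'rV['I_k]_d) : set 'rV[R]_d :=
  [set x | unit_cube x /\ exists2 w, nu w = x & accepts A w].

End Representation.

Arguments recognized R {k d} A.

Section Dimension.
Variables (R : realType) (d : nat).
Implicit Types X U : set 'rV[R]_d.

(* The norm of the library on row vectors is the sup norm. *)
Definition eucl_dist (x y : 'rV[R]_d) : R :=
  Num.sqrt (\sum_(j < d) (x ord0 j - y ord0 j) ^+ 2).

Local Open Scope ereal_scope.

(* The diameter of the empty set is -oo. *)
Definition diam U : \bar R :=
  ereal_sup [set (eucl_dist p.1 p.2)%:E | p in U `*` U].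

(* With the library's 0 `^ 0 = 1, points have weight 1 when s = 0. *)
Definition diam_pow (s : R) U : \bar R :=
  if U == set0 then 0 else poweR (diam U) s.

Definition hausdorff_premeasure (s delta : R) X : \bar R :=
  ereal_inf [set \sum_(0 <= i <oo) diam_pow s (U i) |
    U in [set U : nat -> set 'rV[R]_d |
      (forall i, diam (U i) <= delta%:E) /\ X `<=` \bigcup_i U i]].

(* The premeasure is nonincreasing in delta, so this supremum is its limit as
   delta tends to 0. *)
Definition hausdorff_measure (s : R) X : \bar R :=
  ereal_sup [set hausdorff_premeasure s delta X |
    delta in [set delta : R | (0 < delta)%R]].

Definition hausdorff_dim X : \bar R :=
  ereal_inf [set s%:E |
    s in [set s : R | (0 <= s)%R /\ hausdorff_measure s X = 0]].

(* The least number of sets of diameter at most e that cover X, +oo if there is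
   no finite cover. *)
Definition covering_number X (e : R) : \bar R :=
  ereal_inf [set n%:R%:E | n in [set n : nat |
    exists U : 'I_n -> set 'rV[R]_d,
      (forall i, diam (U i) <= e%:E) /\ X `<=` \bigcup_i U i]].

(* The box-counting dimension of X exists and is equal to s. *)
Definition has_box_dim X (s : \bar R) : Prop :=
  lne (covering_number X e) * ((ln e^-1)^-1)%:E @[e --> 0^'+] --> s.

End Dimension.

(* Main.v *)
Require Import Defs.
From mathcomp Require Import all_boot all_order all_algebra.
From mathcomp Require Import all_classical all_reals all_analysis.
From mathcomp Require Import ring lra zify.
Import Order.TTheory GRing.Theory Num.Theory.
Import numFieldNormedType.Exports.

Set Implicit Arguments.
Unset Strict Implicit.
Unset Printing Implicit Defensive.

Local Open Scope classical_set_scope.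
Local Open Scope ring_scope.

(** Base-[k] prefixes of length [n] correspond to grid cubes of side [k ^- n],
    and a set of diameter of that order meets only a bounded number of such
    cubes ([few_prefixes]). Both dimensions thus become questions on numbers of
    words, and every growth rate is phrased as a comparison with [expR t ^+ n]
    for [t] on either side of an entropy.

    Hausdorff dimension, upper bound ([hausdorff_recognized_null]). An
    accepting run returns infinitely often to some accept state [q]; hence, for
    some position [i], the accepted word continues after [i] with cycles at [q]
    of unboundedly many lengths. For fixed [q] and [i] the cubes of the words
    that continue with a cycle of length at least [n] form a cover whose
    [s]-dimensional cost is the tail of a convergent geometric series as soon
    as [s] exceeds the entropy of the cycles divided by [ln k]. There are
    countably many pairs [(q, i)].

    Hausdorff dimension, lower bound ([hausdorff_recognized_gt0]). Fix a length
    [m] for which an accept state [q] has many cycles of length [m], and call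
    these the blocks. After a walk from a start state to [q], all infinite
    sequences of blocks are accepted; they form a self-similar Cantor set, on
    which the uniform Bernoulli measure satisfies the mass distribution
    principle ([mass_distribution]). The measure enters only through Kraft's
    inequality ([kraft]): if a cover were too cheap, then an uncovered infinite
    word could be written down letter by letter.

    Box dimension. In a trim automaton the words read along walks from start
    states are exactly the prefixes of accepted words, so the covering number
    at scale [k ^- n] is comparable to the number of these prefixes. From below
    it is bounded by the block construction, now at an arbitrary state [q],
    each finite sequence of blocks being extended to an accepted word
    ([covering_recognized_lower]). From above, a walk is cut at its last visit
    to its first state into a cycle and a walk that avoids this state; by
    induction on the set of allowed states, walks grow no faster than cycles
    ([walk_lang_count_le], [covering_recognized_upper]). As the bounds from
    below hold for all [n], not just along a sequence, the limit exists although
    the entropies are upper limits. *)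

(** * Walks and infinite runs *)

Section Walks.
Variables (Sigma : finType) (A : buchi Sigma).
Local Notation Q := (state A).
Implicit Types (p q : Q) (z : seq (Sigma * Q)) (w : seq Sigma).

(** A walk records each letter together with the state it leads to, so that
    words and runs are concatenated and cut simultaneously. *)
Fixpoint walk p z : bool :=
  if z is (a, q) :: z' then (q \in trans p a) && walk q z' else true.

Definition target p z : Q := last p (unzip2 z).

Lemma walk_cat p z1 z2 : walk p (z1 ++ z2) = walk p z1 && walk (target p z1) z2.
Proof. by elim: z1 p => [|[a q] z IH] p //=; rewrite IH andbA. Qed.

Lemma target_cat p z1 z2 : target p (z1 ++ z2) = target (target p z1) z2.
Proof. by rewrite /target /unzip2 map_cat last_cat. Qed.

Lemma walk_nth p z a0 i : walk p z -> (i < size z)%N ->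
  nth p (p :: unzip2 z) i.+1
    \in trans (nth p (p :: unzip2 z) i) (nth a0 (unzip1 z) i).
Proof.
elim: z p i => [|[a q] z IH] p [|i] //= /andP[hq hz] hi //.
have := IH q i hz hi; rewrite /= => hh.
rewrite (set_nth_default q) ?size_map //.
by case: i {IH} hi hh => [|i] //= hi hh; rewrite (set_nth_default q p) ?size_map // ltnW.
Qed.

Lemma path_walk q s : path (edge (A := A)) q s ->
  exists z, walk q z /\ unzip2 z = s.
Proof.
elim: s q => [|p s IH] q /=; first by exists [::].
case/andP=> /existsP[a ha] /IH[z [hz <-]].
by exists ((a, p) :: z); rewrite /= ha.
Qed.

Lemma run_walk (r : nat -> Q) w :
  (forall i : 'I_(size w), r i.+1 \in trans (r i) (tnth (in_tuple w) i)) ->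
  exists z, [/\ walk (r 0%N) z, target (r 0%N) z = r (size w) & unzip1 z = w].
Proof.
elim: w r => [|a w IH] r hr; first by exists [::].
have [i|z [hz ht hw]] := IH (r \o S).
  have := hr (lift ord0 i); rewrite (tnth_nth a) (tnth_nth a).
  by rewrite lift0.
exists ((a, r 1%N) :: z); split => //=; last by rewrite hw.
by rewrite hz andbT; have := hr ord0; rewrite (tnth_nth a).
Qed.

Lemma cycle_langP q w : cycle_lang q w <->
  exists z, [/\ walk q z, target q z = q & unzip1 z = w].
Proof.
split=> [[r [h0 hw hr]]|[z [hz ht <-]]].
  by have := run_walk hr; rewrite h0 hw.
exists (nth q (q :: unzip2 z)); split => //.
  by rewrite /unzip1 size_map -(size_map snd) -last_nth.
move=> i; have hi : (i < size z)%N by rewrite -(size_map fst).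
have [a _] : exists a : Sigma, True by case: z hz ht i hi => [|[a p] z] // *; exists a.
by rewrite (tnth_nth a); exact: walk_nth.
Qed.

Section Concatenation.
Variables (Z : nat -> seq (Sigma * Q)) (s : nat -> Q) (a0 : Sigma).
Hypothesis Zwalk : forall n, walk (s n) (Z n).
Hypothesis Ztarget : forall n, target (s n) (Z n) = s n.+1.
Hypothesis Zn0 : forall n, Z n != [::].

Definition concat n := flatten (mkseq Z n).

Lemma concatS n : concat n.+1 = concat n ++ Z n.
Proof. by rewrite /concat mkseqS flatten_rcons. Qed.

Lemma concat_walk n : walk (s 0%N) (concat n) /\ target (s 0%N) (concat n) = s n.
Proof.
elim: n => [|n [IHw IHt]] //.
by rewrite concatS walk_cat target_cat IHt IHw Zwalk Ztarget.
Qed.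

Lemma size_concat n : (n <= size (concat n))%N.
Proof.
elim: n => // n IH; rewrite concatS size_cat -addn1 leq_add //.
by rewrite lt0n size_eq0 Zn0.
Qed.

Lemma concat_prefix m n : (m <= n)%N -> exists z, concat n = concat m ++ z.
Proof.
move=> /subnK <-; elim: (n - m)%N => [|i [z hz]]; first by exists [::]; rewrite cats0.
by exists (z ++ Z (i + m)); rewrite addSn concatS hz catA.
Qed.

(** Of any two finite concatenations one is a prefix of the other, so that the
    word and its run can be read off position by position; the pieces being
    nonempty, [concat i.+1] is long enough for position [i]. *)
Lemma infinite_run : exists (w : nat -> Sigma) r,
  [/\ r 0%N = s 0%N, forall i, r i.+1 \in trans (r i) (w i),
      forall n, r (size (concat n)) = s n &
      forall n i, (i < size (concat n))%N ->
        w i = nth a0 (unzip1 (concat n)) i].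
Proof.
pose r i := nth (s 0%N) (s 0%N :: unzip2 (concat i)) i.
pose w i := nth a0 (unzip1 (concat i.+1)) i.
have rE n i : (i <= size (concat n))%N ->
    r i = nth (s 0%N) (s 0%N :: unzip2 (concat n)) i.
  move=> hi; rewrite /r; case: (leqP i n) => hin.
    have [z ->] := concat_prefix hin.
    rewrite /unzip2 map_cat -cat_cons nth_cat /= size_map ltnS.
    by rewrite size_concat.
  have [z hz] := concat_prefix (ltnW hin).
  rewrite hz /unzip2 map_cat -cat_cons nth_cat /= size_map ltnS.
  by rewrite hi.
have wE n i : (i < size (concat n))%N -> w i = nth a0 (unzip1 (concat n)) i.
  move=> hi; rewrite /w; case: (leqP i.+1 n) => hin.
    have [z ->] := concat_prefix hin.
    by rewrite /unzip1 map_cat nth_cat size_map size_concat.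
  have [z ->] := concat_prefix (ltnW hin).
  by rewrite /unzip1 map_cat nth_cat size_map hi.
exists w, r; split => //.
  move=> i; have hi := size_concat i.+1.
  rewrite (rE i.+1 i.+1) // (rE i.+1 i (ltnW hi)).
  by apply: walk_nth => //; case: (concat_walk i.+1).
move=> n; rewrite (rE n) // -{1}(size_map snd) -last_nth.
by case: (concat_walk n).
Qed.

End Concatenation.

Lemma infinite_set_nat (B : set nat) :
  infinite_set B <-> forall n, exists2 i, (n <= i)%N & B i.
Proof.
split=> [hB n|hB /finite_seqP[l hl]].
  apply: contrapT => hn; apply: hB; apply: (sub_finite_set _ (finite_II n)).
  move=> i Bi /=; rewrite ltnNge; apply/negP => hi; apply: hn.
  by exists i.
have [i hi] := hB (\max_(j <- l) j).+1.
rewrite hl /= => il; move: hi; rewrite ltnNge.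
by rewrite leq_bigmax_seq.
Qed.

(** All junctions between pieces, except possibly the first state, are accept
    states, and they occur at unboundedly late positions. *)
Lemma concat_accepts (Z : nat -> seq (Sigma * Q)) (s : nat -> Q) (a0 : Sigma) :
  s 0%N \in start A ->
  (forall n, walk (s n) (Z n)) -> (forall n, target (s n) (Z n) = s n.+1) ->
  (forall n, Z n != [::]) -> (forall n, s n.+1 \in accept A) ->
  exists2 w : nat -> Sigma, accepts A w & forall n i, (i < size (concat Z n))%N ->
        w i = nth a0 (unzip1 (concat Z n)) i.
Proof.
move=> s0 hw ht hn hacc.
have [w [r [r0 hr rs hwn]]] := infinite_run a0 hw ht hn.
exists w => //; exists r; first by split => //; rewrite r0.
apply/infinite_set_nat => n; exists (size (concat Z n.+1)).
  exact: leq_trans (leqnSn _) (size_concat hn _).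
by rewrite /= rs.
Qed.

Section Trim.
Hypothesis Atrim : trim A.

Lemma trim_reach q : exists z p, [/\ p \in start A, walk p z & target p z = q].
Proof.
have [[p [s [hp hs ht]]] _] := Atrim q; have [z [hz hzs]] := path_walk hs.
by exists z, p; split => //; rewrite /target hzs.
Qed.

Lemma trim_accept q : exists z, [/\ z != [::], walk q z & target q z \in accept A].
Proof.
have [_ [s [hn hs ht]]] := Atrim q; have [z [hz hzs]] := path_walk hs.
exists z; split => //; last by rewrite /target hzs.
by move: hn; rewrite -hzs; case: (z).
Qed.

(** In a trim automaton a run can always proceed to a further accept state, and
    infinitely often so. *)
Lemma trim_extend a0 p z : p \in start A -> walk p z ->
  exists2 w : nat -> Sigma, accepts A w &
    forall i, (i < size z)%N -> w i = nth a0 (unzip1 z) i.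
Proof.
move=> hp hz.
have [f hf] := choice trim_accept.
(* The first piece contains the given walk [z]; it may be empty, so it is glued
   to the walk that leads to the first accept state. *)
pose s := fix s n := if n is n'.+1 then
  (if n' is 0 then target p (z ++ f (target p z)) else target (s n') (f (s n')))
  else p.
pose Z n := if n is 0 then z ++ f (target p z) else f (s n).
have [|||||w hw hwn] := @concat_accepts Z s a0 => //.
- by case=> [|n]; [rewrite /= walk_cat hz; case: (hf (target p z))|case: (hf (s n.+1))].
- by case.
- case=> [|n]; last by case: (hf (s n.+1)).
  by rewrite /=; case: z {hz s Z} => [|//]; case: (hf (target p [::])).
- case=> [|n]; last by case: (hf (s n.+1)).
  by rewrite /= target_cat; case: (hf (target p z)).
have Z1 : concat Z 1 = z ++ f (target p z) by rewrite /concat /= cats0.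
exists w => // i hi; rewrite (hwn 1%N) Z1 ?size_cat ?ltn_addr //.
by rewrite /unzip1 map_cat nth_cat size_map hi.
Qed.

End Trim.

End Walks.

(** * Counting words: walks grow no faster than cycles *)

Section Counting.
Variable Sigma : finType.
Implicit Types (L : set (seq Sigma)) (w : seq Sigma).

Definition words L n : seq (seq Sigma) :=
  [seq val t | t <- enum [pred t : n.-tuple Sigma | `[< L (val t) >]]].

Lemma size_words L n : size (words L n) = lang_count L n.
Proof. by rewrite size_map -cardE. Qed.

Lemma words_uniq L n : uniq (words L n).
Proof. by rewrite map_inj_uniq ?enum_uniq //; exact: val_inj. Qed.

Lemma mem_words L n w : w \in words L n <-> size w = n /\ L w.
Proof.
split=> [/mapP[t]|[<- Lw]].
  by rewrite mem_enum inE => Lt ->; split; [exact: size_tuple|].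
by apply/mapP; exists (in_tuple w) => //; rewrite mem_enum inE.
Qed.

Lemma lang_count_le_size L n (l : seq (seq Sigma)) :
  (forall w, size w = n -> L w -> w \in l) -> (lang_count L n <= size l)%N.
Proof.
move=> h; rewrite -size_words; apply: (uniq_leq_size (words_uniq L n)) => w /mem_words[hw Lw].
exact: h.
Qed.

Lemma lang_count_le_sum L n (I : finType) (P : pred I) (F : I -> seq (seq Sigma)) :
  (forall w, size w = n -> L w -> exists2 i, P i & w \in F i) ->
  (lang_count L n <= \sum_(i | P i) size (F i))%N.
Proof.
move=> h.
suff -> : (\sum_(i | P i) size (F i))%N = size (flatten [seq F i | i <- enum P]).
  apply: lang_count_le_size => w hw Lw; have [i Pi wi] := h w hw Lw.
  by apply/flatten_mapP; exists i; rewrite ?mem_enum.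
by rewrite size_flatten sumnE !big_map big_enum.
Qed.

Lemma lang_count_le L n : (lang_count L n <= #|Sigma| ^ n)%N.
Proof. by rewrite -card_tuple; exact: max_card. Qed.

Lemma lang_count_gt0 L w : L w -> (0 < lang_count L (size w))%N.
Proof.
move=> Lw; have := (mem_words L (size w) w).2 (conj erefl Lw).
by rewrite -size_words; case: (words _ _).
Qed.

End Counting.

Section WalkCount.
Variables (R : realType) (Sigma : finType) (A : buchi Sigma).
Local Notation Q := (state A).
Implicit Types (p q : Q) (T : {set Q}) (w : seq Sigma).

Definition walk_lang T p : set (seq Sigma) :=
  [set w | exists z, [/\ walk p z, all (mem T) (unzip2 z) & unzip1 z = w]].

Definition prefix_lang : set (seq Sigma) :=
  [set w | exists p z, [/\ p \in start A, walk p z & unzip1 z = w]].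

Lemma last_visit p p0 (z : seq (Sigma * Q)) :
  all (predC1 p) (unzip2 z) \/
  exists z1 z2, [/\ z = z1 ++ z2, target p0 z1 = p & all (predC1 p) (unzip2 z2)].
Proof.
elim: z p0 => [|[a q] z IH] p0; first by left.
case: (IH q) => [h|[z1 [z2 [-> h1 h2]]]]; last first.
  by right; exists ((a, q) :: z1), z2.
have [qp|qp] := eqVneq q p; last by left; rewrite /= qp.
by right; exists [:: (a, q)], z.
Qed.

(** A walk splits at its last visit to its starting state into a cycle and a
    walk that avoids this state; this drives the induction on the set of
    allowed states. *)
Lemma walk_lang_last_visit T p w : walk_lang T p w ->
  exists2 i : 'I_(size w).+1,
    cycle_lang p (take i w) & walk_lang (T :\ p) p (drop i w).
Proof.
move=> [z [hz hT <-]].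
have [z1 [z2 [zE h1 h2]]] : exists z1 z2,
    [/\ z = z1 ++ z2, target p z1 = p & all (predC1 p) (unzip2 z2)].
  by case: (last_visit p p z) => // h; exists [::], z.
move: hz hT; rewrite zE walk_cat h1 /unzip2 map_cat all_cat.
move=> /andP[hz1 hz2] /andP[_ hT].
have hs : (size z1 < (size (unzip1 (z1 ++ z2))).+1)%N.
  by rewrite size_map size_cat ltnS leq_addr.
exists (Ordinal hs) => /=; rewrite /unzip1 map_cat -(size_map fst z1).
  by rewrite take_size_cat //; apply/cycle_langP; exists z1.
rewrite drop_size_cat //; exists z2; split => //.
by apply/allP => q hq; rewrite /= in_setD1; have /= -> := allP h2 q hq; exact: (allP hT).
Qed.

Lemma walk_lang_cons T p a w : walk_lang T p (a :: w) ->
  exists2 q, q \in T & walk_lang T q w.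
Proof.
move=> [[|[b q] z] [//= /andP[_ hz] /andP[qT hT] [_ <-]]].
by exists q => //; exists z.
Qed.

Lemma walk_lang_count_split T p n :
  (lang_count (walk_lang T p) n <=
   \sum_(i < n.+1) lang_count (cycle_lang p) i *
                   lang_count (walk_lang (T :\ p) p) (n - i))%N.
Proof.
pose F (i : 'I_n.+1) := [seq u ++ v | u <- words (cycle_lang p) i,
  v <- words (walk_lang (T :\ p) p) (n - i)].
rewrite (eq_bigr (fun i => size (F i))); last first.
  by move=> i _; rewrite /F size_allpairs !size_words.
apply: lang_count_le_sum => w hw /walk_lang_last_visit[i h1 h2].
have hi : (i < n.+1)%N by rewrite -hw.
exists (Ordinal hi) => //; apply/allpairsP; exists (take i w, drop i w).
rewrite cat_take_drop; split => //; apply/mem_words; split => //.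
  by rewrite size_take_min; apply/minn_idPl; rewrite -ltnS.
by rewrite size_drop; exact: (congr1 (subn^~ i) hw).
Qed.

Lemma walk_lang_count_step T p n :
  (lang_count (walk_lang T p) n.+1 <=
   \sum_(x : Sigma * Q | x.2 \in T) lang_count (walk_lang T x.2) n)%N.
Proof.
pose F (x : Sigma * Q) := [seq x.1 :: v | v <- words (walk_lang T x.2) n].
rewrite (eq_bigr (fun i => size (F i))); last first.
  by move=> i _; rewrite /F size_map size_words.
apply: lang_count_le_sum => [[|a w]] //= [hw] /walk_lang_cons[q qT hq].
by exists (a, q) => //; apply/mapP; exists w => //; apply/mem_words.
Qed.

(** The gap between [a] and [b] keeps a convolution of [a ^+ i] and [b ^+ j]
    at the order [b ^+ n], without a polynomial factor. *)
Lemma sum_geometric_le (a b : R) n : 0 <= a -> a < b ->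
  \sum_(i < n.+1) a ^+ i * b ^+ (n - i) <= b / (b - a) * b ^+ n.
Proof.
move=> a0 ab; rewrite mulrAC ler_pdivlMr ?subr_gt0 // -exprS.
have -> : (\sum_(i < n.+1) a ^+ i * b ^+ (n - i)) * (b - a) = b ^+ n.+1 - a ^+ n.+1.
  rewrite subrXX mulrC; congr (_ * _); apply: eq_bigr => i _.
  by rewrite mulrC.
by rewrite gerBl exprn_ge0.
Qed.

(** Words labelling walks grow no faster than cycles. A walk from an allowed
    state is a cycle followed by a walk that avoids this state, which is the
    inductive case; a walk from any other state enters the allowed ones after
    one letter. *)
Lemma walk_lang_count_le (a b : R) : 0 <= a -> a < b ->
  (forall q : Q, exists C : R, forall n, (lang_count (cycle_lang q) n)%:R <= C * a ^+ n) ->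
  forall T, exists C : R, forall p n,
    (lang_count (walk_lang T p) n)%:R <= C * b ^+ n.
Proof.
move=> a0 ab hC; have b0 : 0 < b by exact: le_lt_trans ab.
have {hC} [C hC] := choice hC.
have C0 q : 0 <= C q.
  by have := hC q 0%N; rewrite expr0 mulr1; exact: le_trans.
move=> T; move: {2}#|T|.+1 (ltnSn #|T|) => m; elim: m T => // m IH T hT.
(* [E] bounds the walks that start inside [T]. *)
have [E hE] : exists E : Q -> R, forall p n, p \in T ->
    (lang_count (walk_lang T p) n)%:R <= E p * b ^+ n.
  suff /choice[E hE] : forall p, exists E : R, forall n, p \in T ->
      (lang_count (walk_lang T p) n)%:R <= E * b ^+ n by exists E.
  move=> p; have [pT|pT] := boolP (p \in T); last by exists 0.
  have [|D hD] := IH (T :\ p); first by move: hT; rewrite (cardsD1 p) pT.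
  exists (C p * D * (b / (b - a))) => n _.
  have := walk_lang_count_split T p n; rewrite -(ler_nat R) => /le_trans; apply.
  rewrite natr_sum -mulrA (le_trans _ (ler_wpM2l _ (sum_geometric_le n a0 ab))) //.
    rewrite mulr_sumr ler_sum // => i _; rewrite natrM.
    by rewrite mulrACA ler_pM.
  rewrite mulr_ge0 //.
  by have := hD p 0%N; rewrite expr0 mulr1; exact: le_trans.
have E0 p : p \in T -> 0 <= E p.
  by move=> /(hE p 0%N); rewrite expr0 mulr1; exact: le_trans.
pose S := \sum_(p in T) E p; have S0 : 0 <= S by rewrite sumr_ge0.
have SE p : p \in T -> E p <= S.
  by move=> pT; rewrite /S (bigD1 p) //= lerDl sumr_ge0 // => q /andP[/E0].
(* [1] accounts for the empty word, the last sum for the first letter of a walk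
   that starts outside [T]. *)
exists (S + (1 + \sum_(x : Sigma * Q | x.2 \in T) S / b)) => p n.
have bn0 : 0 < b ^+ n by rewrite exprn_gt0.
have S1 : 0 <= \sum_(x : Sigma * Q | x.2 \in T) S / b.
  by rewrite sumr_ge0 // => *; rewrite divr_ge0 // ltW.
have [pT|pT] := boolP (p \in T).
  rewrite (le_trans (hE p n pT)) // ler_wpM2r ?(ltW bn0) //.
  by rewrite (le_trans (SE p pT)) // lerDl addr_ge0.
case: n {bn0} => [|n].
  rewrite expr0 mulr1 (@le_trans _ _ 1) //.
    by have := lang_count_le (walk_lang T p) 0; rewrite expn0 -(ler_nat R).
  by rewrite addrCA lerDl addr_ge0.
have := walk_lang_count_step T p n; rewrite -(ler_nat R) => /le_trans; apply.
rewrite natr_sum (@le_trans _ _ (\sum_(x : Sigma * Q | x.2 \in T) S / b * b ^+ n.+1)) //.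
  apply: ler_sum => x xT; rewrite exprS mulrA divfK ?gt_eqF //.
  by rewrite (le_trans (hE _ _ xT)) // ler_wpM2r ?SE // exprn_ge0 // ltW.
rewrite -mulr_suml ler_wpM2r ?exprn_ge0 ?(ltW b0) //.
by rewrite addrA lerDr addr_ge0.
Qed.

Lemma prefix_count_le (a b : R) : 0 <= a -> a < b ->
  (forall q : Q, exists C : R, forall n, (lang_count (cycle_lang q) n)%:R <= C * a ^+ n) ->
  exists C : R, forall n, (lang_count prefix_lang n)%:R <= C * b ^+ n.
Proof.
move=> a0 ab hC; have [C h] := walk_lang_count_le a0 ab hC [set: Q].
exists (#|Q|%:R * C) => n.
apply: (@le_trans _ _ (\sum_(p : Q) (lang_count (walk_lang [set: Q] p) n)%:R)).
  rewrite -natr_sum ler_nat.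
  under eq_bigr do rewrite -size_words.
  apply: lang_count_le_sum => w hw [p [z [_ hz zw]]].
  exists p => //; apply/mem_words; split=> //.
  by exists z; split => //; apply/allP => q _; rewrite /= inE.
apply: (@le_trans _ _ (\sum_(p : Q) C * b ^+ n)); first exact: ler_sum.
by rewrite sumr_const -mulrA mulr_natl.
Qed.

End WalkCount.

(** * Entropy as a growth rate *)

Section EntropyBounds.
Variables (R : realType) (Sigma : finType).
Implicit Types (L : set (seq Sigma)) (t : R).
Local Open Scope ereal_scope.

Lemma rate_le (c m : nat) t : (0 < m)%N ->
  (lne c%:R%:E * (m%:R^-1)%:E <= t%:E) = (c%:R <= expR t ^+ m)%R.
Proof.
move=> m0; have mR : (0 < m%:R :> R)%R by rewrite ltr0n.
rewrite /lne lern0; case: c => [|c] /=.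
  rewrite mulNyr gtr0_sg ?invr_gt0 // mul1e leNye.
  by rewrite exprn_ge0 // expR_ge0.
rewrite -EFinM lee_fin ler_pdivrMr // -ler_expR lnK ?posrE ?ltr0n //.
by rewrite -expRM_natr.
Qed.

Lemma count_le_of_entropy_lt L t : entropy R L < t%:E ->
  exists N, forall n, (N <= n)%N -> ((lang_count L n)%:R <= expR t ^+ n)%R.
Proof.
move=> /ereal_inf_lt[_ [V [N _ NV] <-]] hV.
exists (maxn N 1) => n; rewrite geq_max => /andP[Nn n0].
rewrite -rate_le //; apply: le_trans (ltW hV); apply: ereal_sup_ubound.
by exists n => //; exact: NV.
Qed.

Lemma count_gt_of_entropy_gt L t N : t%:E < entropy R L ->
  exists2 n, (N < n)%N & (expR t ^+ n < (lang_count L n)%:R)%R.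
Proof.
move=> ht; apply: contrapT => hn; move: ht; apply/negP; rewrite -leNgt.
apply: (@le_trans _ _ (ereal_sup
  [set lne (lang_count L n)%:R%:E * (n%:R^-1)%:E | n in [set n | (N < n)%N]])).
  apply: ereal_inf_lbound; exists [set n | (N < n)%N] => //.
  by exists N.+1.
apply: ge_ereal_sup => _ [n /= Nn <-]; rewrite rate_le ?(leq_ltn_trans _ Nn) //.
by rewrite leNgt; apply/negP => h; apply: hn; exists n.
Qed.

Lemma entropy_le L : entropy R L <= (ln #|Sigma|%:R)%:E.
Proof.
rewrite leNgt; apply/negP => /(count_gt_of_entropy_gt 0)[n n0].
apply/negP; rewrite -leNgt; case: (posnP #|Sigma|) => [S0|S0].
  have := lang_count_le L n; rewrite S0 exp0n // leqn0 => /eqP ->.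
  by rewrite exprn_ge0 // expR_ge0.
by rewrite lnK ?posrE ?ltr0n // -natrX ler_nat lang_count_le.
Qed.

Lemma infinite_langP L :
  infinite_set L <-> forall N, exists2 w, (N <= size w)%N & L w.
Proof.
split=> [Linf N|hL /finite_seqP[l hl]].
  apply: contrapT => hN; apply: Linf.
  apply: (sub_finite_set _ (finite_seq (flatten [seq words setT n | n <- iota 0 N]))).
  move=> w Lw /=; apply/flatten_mapP; exists (size w); last exact/mem_words.
  by rewrite mem_iota ltnNge; apply/negP => hw; apply: hN; exists w.
have [w hw] := hL (\max_(u <- l) size u).+1.
rewrite hl /= => wl; move: hw; rewrite ltnNge.
by rewrite (@leq_bigmax_seq _ _ xpredT size).
Qed.

Lemma entropy_ge0 L : infinite_set L -> 0 <= entropy R L.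
Proof.
move=> /infinite_langP Linf; rewrite leNgt; apply/negP => h.
have [t ht t0] : exists2 t : R, entropy R L < t%:E & (t < 0)%R.
  case: (entropy R L) h => [x| |] //; last by exists (-1)%R; rewrite ?ltNyr ?ltrN10.
  by rewrite lte_fin => x0; exists (x / 2)%R; rewrite ?lte_fin; lra.
have [N hN] := count_le_of_entropy_lt ht.
have [w hw Lw] := Linf (maxn N 1); move: hw; rewrite geq_max => /andP[wN w0].
have := hN _ wN; apply/negP; rewrite -ltNge.
have := lang_count_gt0 Lw; rewrite -(ler_nat R); apply: lt_le_trans.
by rewrite exprn_ilt1 ?expR_ge0 ?expR_lt1 // -lt0n.
Qed.

End EntropyBounds.

Section MaxEntropy.
Variables (R : realType) (Sigma : finType) (A : buchi Sigma).
Implicit Types (P : {set state A}) (t : R).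
Local Open Scope ereal_scope.

Lemma cycle_count_gt P t N : t%:E < max_entropy R P ->
  exists q n, [/\ q \in P, (N < n)%N &
    (expR t ^+ n < (lang_count (cycle_lang q) n)%:R)%R].
Proof.
move=> /bigmax_gtP[//|[q /andP[qP _] /(count_gt_of_entropy_gt N)[n Nn hn]]].
by exists q, n.
Qed.

(** States with a finite cycle language are left out of the maximum, but their
    cycles have bounded length, so that the bound holds for them as well. *)
Lemma cycle_count_le P t q : max_entropy R P < t%:E -> q \in P ->
  exists N, forall n, (N <= n)%N ->
    ((lang_count (cycle_lang q) n)%:R <= expR t ^+ n)%R.
Proof.
move=> ht qP; have [hq|hq] := pselect (infinite_set (cycle_lang q)).
  apply: count_le_of_entropy_lt; move: ht; apply: contraTT.
  rewrite -!leNgt => /le_trans; apply.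
  apply: (le_bigmax_cond _ (fun q => entropy R (cycle_lang q))).
  by rewrite qP; apply/asboolP.
have [N hN] : exists N, forall w, cycle_lang q w -> (size w < N)%N.
  apply: contrapT => hN; apply: hq; apply/infinite_langP => N.
  apply: contrapT => hNw; apply: hN; exists N => w hw.
  by rewrite ltnNge; apply/negP => wN; apply: hNw; exists w.
exists N => n Nn.
have -> : lang_count (cycle_lang q) n = 0%N.
  rewrite -size_words; apply/eqP; rewrite size_eq0; apply/eqP.
  case E: (words _ _) => [//|w l].
  have /mem_words[sw /hN] : w \in words (cycle_lang q) n by rewrite E mem_head.
  by rewrite sw ltnNge Nn.
by rewrite exprn_ge0 // expR_ge0.
Qed.

Lemma cycle_count_le_const t (q : state A) : (0 <= t)%R ->
  max_entropy R [set: state A]%SET < t%:E ->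
  exists C : R, forall n, ((lang_count (cycle_lang q) n)%:R <= C * expR t ^+ n)%R.
Proof.
move=> t0 ht; have [|N hN] := @cycle_count_le _ _ q ht; first by rewrite inE.
exists (1 + #|Sigma|%:R ^+ N)%R => n.
have e1 : (1 <= expR t ^+ n)%R by rewrite exprn_ege1 // -expR0 ler_expR.
have S0 : (0 <= #|Sigma|%:R ^+ N :> R)%R by rewrite exprn_ge0.
have [Nn|nN] := leqP N n.
  rewrite (le_trans (hN n Nn)) // mulrDl mul1r lerDl mulr_ge0 //.
apply: (@le_trans _ _ (1 + #|Sigma|%:R ^+ N)%R); last first.
  by rewrite -[leLHS]mulr1 ler_wpM2l // addr_ge0.
apply: (@le_trans _ _ (#|Sigma|%:R ^+ n)%R).
  by rewrite -natrX ler_nat lang_count_le.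
case: (posnP #|Sigma|) => [S1|S1].
  by rewrite S1 expr0n; case: (n) => [|m] /=; rewrite ?lerDl // addr_ge0 // exprn_ge0.
rewrite (@le_trans _ _ (#|Sigma|%:R ^+ N)%R) ?lerDr //.
by rewrite ler_weXn2l ?ler1n // ltnW.
Qed.

(** Pigeonhole: there are finitely many accept states. *)
Lemma accepting_state (r : nat -> state A) : accepting r ->
  exists2 q, q \in accept A & forall n, exists2 i, (n <= i)%N & r i = q.
Proof.
move=> hr; apply: contrapT => hn; apply: hr.
have fin q : q \in accept A -> finite_set [set i | r i = q].
  move=> qF; apply: contrapT => /infinite_set_nat h; apply: hn.
  by exists q.
apply: (@sub_finite_set _ _ (\bigcup_(q in [set q | q \in accept A]) [set i | r i = q])).
  by move=> i /= ri; exists (r i).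
exact: bigcup_finite.
Qed.

Lemma run_cycle (w : nat -> Sigma) (r : nat -> state A) q i j :
  (forall i, r i.+1 \in trans (r i) (w i)) -> r i = q -> r j = q -> (i <= j)%N ->
  cycle_lang q (mkseq (fun l => w (i + l)%N) (j - i)).
Proof.
move=> hr ri rj ij; exists (fun l => r (i + l)%N).
split => [||l]; rewrite ?addn0 // ?size_mkseq ?subnKC //.
have hl : (l < j - i)%N by have := ltn_ord l; rewrite [X in (_ < X)%N]size_mkseq.
by rewrite (tnth_nth (w 0%N)) /= nth_mkseq // addnS.
Qed.

Section Trim.
Hypothesis Atrim : trim A.

(** The state that an accepting run visits infinitely often lies on arbitrarily
    long cycles. Hence the maxima are not taken over an empty set. *)
Lemma accepting_cycle : exists2 q, q \in accept A & infinite_set (cycle_lang q).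
Proof.
have [p hp] := set0Pn _ (start_neq0 A).
have [a0 _] : exists a : Sigma, True.
  by case: (trim_accept Atrim p) => [[|[a q] z] [//]]; exists a.
have [w [r [_ hr] /accepting_state[q qF hq]] _] :=
  trim_extend Atrim a0 hp (erefl (walk p [::])).
exists q => //; apply/infinite_langP => N.
have [i _ ri] := hq 0%N; have [j hj rj] := hq (i + N)%N.
exists (mkseq (fun l => w (i + l)%N) (j - i)).
  by rewrite size_mkseq leq_subRL // (leq_trans _ hj) // leq_addr.
by apply: (run_cycle hr ri rj); rewrite (leq_trans _ hj) // leq_addr.
Qed.

Lemma max_entropy_fin P : {subset accept A <= P} -> exists2 h : R,
  max_entropy R P = h%:E & (0 <= h)%R.
Proof.
move=> AP; have [q qF hq] := accepting_cycle.
have h0 : 0 <= max_entropy R P.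
  apply: (@le_trans _ _ (entropy R (cycle_lang q))); first exact: entropy_ge0.
  apply: (le_bigmax_cond _ (fun q => entropy R (cycle_lang q))).
  by rewrite AP //; apply/asboolP.
have h1 : max_entropy R P <= (ln #|Sigma|%:R)%:E.
  by apply/bigmax_leP; split => [|p _]; [exact: leNye|exact: entropy_le].
case: (max_entropy R P) h0 h1 => [h| |] //; rewrite lee_fin => h0 _.
by exists h.
Qed.

End Trim.
End MaxEntropy.

(** * Grid cubes and values of words *)

Section Digits.
Variables (R : realType) (k : nat).
Hypothesis k1 : (1 < k)%N.
Implicit Types w : nat -> 'I_k.

Let k0 : (0 < k)%N. Proof. exact: ltnW. Qed.

(** The prefix of length [n] read as an integer in base [k]; divided by
    [k ^ n], it is the left end of the grid interval of all words with this
    prefix. *)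
Fixpoint prefix_val w n : nat :=
  if n is n'.+1 then k * prefix_val w n' + w n' else 0.

Lemma eq_prefix_val w w' n :
  (prefix_val w n = prefix_val w' n) <-> (forall i, (i < n)%N -> w i = w' i).
Proof.
elim: n => [|n IH]; first by split.
split=> /= [|h]; last first.
  by rewrite (h n) // (IH.2 _) // => i hi; apply: h; rewrite ltnS ltnW.
move=> h.
have hd : prefix_val w n = prefix_val w' n.
  have := congr1 (fun m => m %/ k)%N h; rewrite !(mulnC k) !divnMDl //.
  by rewrite !divn_small // !addn0.
move=> i; rewrite ltnS leq_eqVlt => /orP[/eqP ->|]; last exact: IH.1.
by apply: val_inj => /=; move: h; rewrite hd => /addnI.
Qed.

Lemma prefix_val_le w n m : (n <= m)%N ->
  (prefix_val w m < k ^ (m - n) * (prefix_val w n).+1)%N.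
Proof.
move=> /subnK <-; rewrite addnK; elim: (m - n)%N => [|i IH].
  by rewrite expn0 mul1n.
rewrite addSn /= expnS -mulnA -addnS.
apply: (@leq_trans (k * (prefix_val w (i + n)).+1)); last by rewrite leq_mul2l IH orbT.
by rewrite mulnS addnC leq_add2r.
Qed.

Let digit_series w := series (fun i : nat => (w i)%:R / k%:R ^+ i.+1 : R).

Let kn0 n : 0 < k%:R ^+ n :> R.
Proof. by rewrite exprn_gt0 // ltr0n. Qed.

Lemma digit_seriesE w n : digit_series w n = (prefix_val w n)%:R / k%:R ^+ n.
Proof.
elim: n => [|n IH]; first by rewrite /digit_series /series /= big_geq // mul0r.
rewrite /digit_series seriesSr -/(digit_series w) IH /= natrD natrM mulrDl.
by rewrite exprS invfM mulrACA divff ?mul1r // pnatr_eq0 -lt0n.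
Qed.

Lemma nu1_bounds w n :
  (prefix_val w n)%:R / k%:R ^+ n <= nu1 R w <= (prefix_val w n).+1%:R / k%:R ^+ n.
Proof.
have nd : nondecreasing_seq (digit_series w).
  apply/nondecreasing_seqP => m; rewrite /digit_series seriesSr lerDl.
  by rewrite divr_ge0 // exprn_ge0.
have ub m : (n <= m)%N -> digit_series w m <= (prefix_val w n).+1%:R / k%:R ^+ n.
  move=> nm; rewrite digit_seriesE ler_pdivrMr // mulrAC ler_pdivlMr //.
  rewrite -!natrX -!natrM ler_nat -{2}(subnK nm) expnD mulnA leq_mul2r.
  by rewrite (mulnC _.+1) (ltnW (prefix_val_le w nm)) orbT.
have cv : cvgn (digit_series w).
  apply: nondecreasing_is_cvgn => //.
  exists ((prefix_val w n).+1%:R / k%:R ^+ n) => _ [m _ <-].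
  by apply: le_trans (ub (maxn n m) (leq_maxl _ _)); apply: nd; exact: leq_maxr.
apply/andP; split; rewrite /nu1 -/(digit_series w).
  by rewrite -digit_seriesE; exact: nondecreasing_cvgn_le.
by apply: limr_le => //; near=> m; apply: ub; near: m; exact: nbhs_infty_ge.
Unshelve. all: by end_near. Qed.

End Digits.

Section EuclideanDistance.
Variables (R : realType) (d : nat).
Implicit Types x y : 'rV[R]_d.

Lemma coord_le_eucl_dist x y j : `|x ord0 j - y ord0 j| <= eucl_dist x y.
Proof.
rewrite /eucl_dist -sqrtr_sqr ler_wsqrtr // (bigD1 j) //= lerDl sumr_ge0 //.
by move=> i _; exact: sqr_ge0.
Qed.

Lemma eucl_dist_le x y (c : R) : 0 <= c ->
  (forall j, `|x ord0 j - y ord0 j| <= c) -> eucl_dist x y <= d%:R * c.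
Proof.
move=> c0 h; have dc0 : 0 <= d%:R * c by rewrite mulr_ge0.
rewrite /eucl_dist -[leRHS]ger0_norm // -sqrtr_sqr ler_wsqrtr //.
apply: (@le_trans _ _ (\sum_(j < d) c ^+ 2)).
  by apply: ler_sum => j _; rewrite -real_normK ?num_real // lerXn2r ?nnegrE.
rewrite sumr_const card_ord exprMn -[leLHS]mulr_natl ler_wpM2r ?sqr_ge0 //.
rewrite -natrX ler_nat; case: (d) => // m.
by rewrite expnS leq_pmulr // expn1.
Qed.

Lemma eucl_dist_le_diam (U : set 'rV[R]_d) x y :
  U x -> U y -> ((eucl_dist x y)%:E <= diam U)%E.
Proof. by move=> Ux Uy; apply: ereal_sup_ubound; exists (x, y). Qed.

Lemma diam_le (U : set 'rV[R]_d) (c : R) :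
  (forall x y, U x -> U y -> eucl_dist x y <= c) -> (diam U <= c%:E)%E.
Proof.
move=> h; apply: ge_ereal_sup => _ [[x y] [/= Ux Uy] <-].
by rewrite lee_fin; exact: h.
Qed.

Lemma eucl_dist_ge0 x y : 0 <= eucl_dist x y.
Proof. exact: sqrtr_ge0. Qed.

End EuclideanDistance.

Section Cylinders.
Variables (R : realType) (k d : nat).
Hypothesis k1 : (1 < k)%N.
Local Notation word := (nat -> 'rV['I_k]_d).
Implicit Types w : word.

Let kn0 n : 0 < k%:R ^+ n :> R.
Proof. by rewrite exprn_gt0 // ltr0n ltnW. Qed.

Lemma nu_unit_cube w : unit_cube (nu R w).
Proof.
move=> j; rewrite mxE; have := nu1_bounds R k1 (fun i => w i ord0 j) 0.
by rewrite /= expr0 !divr1.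
Qed.

Lemma eucl_dist_nu_le w w' n : (forall i, (i < n)%N -> w i = w' i) ->
  eucl_dist (nu R w) (nu R w') <= d%:R / k%:R ^+ n.
Proof.
move=> h; apply: eucl_dist_le => [|j]; first by rewrite invr_ge0 ltW.
rewrite !mxE; have := nu1_bounds R k1 (fun i => w' i ord0 j) n.
have := nu1_bounds R k1 (fun i => w i ord0 j) n.
have -> : prefix_val (fun i => w i ord0 j) n = prefix_val (fun i => w' i ord0 j) n.
  by apply/(eq_prefix_val k1) => i hi; rewrite h.
move=> /andP[h1 h2] /andP[h3 h4].
rewrite -(natr1 (prefix_val _ _)) mulrDl mul1r in h2 h4.
by rewrite ler_norml; apply/andP; split; lra.
Qed.

Lemma close_prefix_val w w' n K :
  eucl_dist (nu R w) (nu R w') <= K%:R / k%:R ^+ n ->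
  forall j, (prefix_val (fun i => w i ord0 j) n <=
             prefix_val (fun i => w' i ord0 j) n + K.+1)%N.
Proof.
move=> h j; have := le_trans (coord_le_eucl_dist (nu R w) (nu R w') j) h.
rewrite !mxE ler_norml => /andP[_ hj].
have /andP[h1 _] := nu1_bounds R k1 (fun i => w i ord0 j) n.
have /andP[_ h2] := nu1_bounds R k1 (fun i => w' i ord0 j) n.
rewrite -(ler_nat R) -(ler_pM2r (_ : 0 < (k%:R ^+ n)^-1)) ?invr_gt0 //.
apply: le_trans h1 _; rewrite addnS -addSn natrD mulrDl.
by move: hj h2; lra.
Qed.

(** Two points at distance at most [K * k ^- n] lie in grid cubes whose integer
    corners differ by at most [K + 1] in each coordinate, so the corners of all
    cubes met by [U] lie in a window of [2 * K + 3] integers per coordinate; a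
    corner determines the prefix. *)
Lemma few_prefixes (T : finType) (V : {set T}) (g : T -> word) n K
    (U : set 'rV[R]_d) :
  (forall t, t \in V -> U (nu R (g t))) -> (diam U <= (K%:R / k%:R ^+ n)%:E)%E ->
  {in V &, forall t t', (forall i, (i < n)%N -> g t i = g t' i) -> t = t'} ->
  (#|V| <= (2 * K + 3) ^ d)%N.
Proof.
move=> VU dU inj; have [->|[t0 t0V]] := set_0Vmem V; first by rewrite cards0.
pose c t j := prefix_val (fun i => g t i ord0 j) n.
have hc t t' j : t \in V -> t' \in V -> (c t j <= c t' j + K.+1)%N.
  move=> tV t'V; apply: close_prefix_val.
  by rewrite -lee_fin (le_trans _ dU) // eucl_dist_le_diam //; exact: VU.
(* The corner relative to that of [t0], shifted by [K + 1] to be nonnegative. *)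
pose phi t := [ffun j : 'I_d => inord (c t j + K.+1 - c t0 j) : 'I_(2 * K + 2).+1].
have phi_inj : {in V &, injective phi}.
  move=> t t' tV t'V /ffunP e; apply: inj => // i hi.
  apply/rowP => j; have := e j; rewrite !ffunE => /(congr1 val) /=.
  have h1 := hc _ _ j tV t0V; have h2 := hc _ _ j t'V t0V.
  have h3 := hc _ _ j t0V tV; have h4 := hc _ _ j t0V t'V.
  rewrite !inordK; [|lia|lia] => e2.
  have ee : c t j = c t' j by lia.
  by have := (eq_prefix_val k1 _ _ _).1 ee i hi.
rewrite -(card_in_imset phi_inj) (leq_trans (max_card _)) //.
by rewrite card_ffun !card_ord addn3 addn2.
Qed.

End Cylinders.

(** * Hausdorff premeasure *)

Lemma geometric_small (R : realType) (C r e : R) N : 0 <= r -> r < 1 -> 0 < e ->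
  exists2 n, (N <= n)%N & C * r ^+ n <= e.
Proof.
move=> r0 r1 e0.
have : geometric C r @ \oo --> (0 : R) by apply: cvg_geometric; rewrite ger0_norm.
move=> /cvgrPdist_le /(_ e e0) [M _ hM].
exists (maxn N M); first exact: leq_maxl.
have := hM (maxn N M) (leq_maxr _ _); rewrite /= sub0r normrN.
by apply: le_trans; exact: ler_norm.
Qed.

Section Hausdorff.
Variables (R : realType) (d : nat).
Implicit Types (X U : set 'rV[R]_d) (s delta : R).
Local Open Scope ereal_scope.

Lemma diam_set0 : diam (@set0 'rV[R]_d) = -oo.
Proof.
rewrite /diam; apply/eqP; rewrite -leeNy_eq; apply: ge_ereal_sup.
by move=> _ [[x y] [[]]].
Qed.

Lemma diam_ge0 U x : U x -> 0 <= diam U.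
Proof.
move=> Ux; apply: le_trans (eucl_dist_le_diam Ux Ux).
by rewrite lee_fin eucl_dist_ge0.
Qed.

Lemma diam_pow_ge0 s U : 0 <= diam_pow s U.
Proof. by rewrite /diam_pow; case: ifP => // _; exact: poweR_ge0. Qed.

Lemma diam_pow_le s U (c : R) : (0 <= s)%R -> diam U <= c%:E ->
  diam_pow s U <= (c `^ s)%:E.
Proof.
move=> s0 hc; rewrite /diam_pow; case: eqP => [_|/eqP/set0P[x Ux]].
  by rewrite lee_fin powR_ge0.
have := diam_ge0 Ux; case: (diam U) hc => [r| |] //; rewrite !lee_fin => rc r0.
by rewrite ge0_ler_powR ?nnegrE // (le_trans r0).
Qed.

Lemma premeasure_ge0 s delta X : 0 <= hausdorff_premeasure s delta X.
Proof.
apply: le_ereal_inf_tmp => _ [U _ <-]; apply: nneseries_ge0 => *.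
exact: diam_pow_ge0.
Qed.

Lemma premeasure_subset s delta X X' : X `<=` X' ->
  hausdorff_premeasure s delta X <= hausdorff_premeasure s delta X'.
Proof.
move=> XX'; apply: le_ereal_inf_tmp => _ [U [dU XU] <-].
apply: ereal_inf_lbound; exists U => //; split => //.
exact: subset_trans XU.
Qed.

Lemma premeasure_finite_cover s delta X (c : R) (T : eqType) (l : seq T)
    (U : T -> set 'rV[R]_d) :
  (0 <= s)%R -> (c <= delta)%R -> (forall v, v \in l -> diam (U v) <= c%:E) ->
  (forall x, X x -> exists2 v, v \in l & U v x) ->
  hausdorff_premeasure s delta X <= ((size l)%:R * c `^ s)%:E.
Proof.
move=> s0 cd dU XU; pose V i := nth set0 (map U l) i.
have V0 i : (size l <= i)%N -> V i = set0.
  by move=> hi; rewrite /V nth_default ?size_map.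
have Vc i : diam (V i) <= c%:E.
  have [/V0 ->|hi] := leqP (size l) i; first by rewrite diam_set0 leNye.
  have v0 : T by case: (l) hi.
  by rewrite /V (nth_map v0) // dU // mem_nth.
apply: (@le_trans _ _ (\sum_(0 <= i <oo) diam_pow s (V i))).
  apply: ereal_inf_lbound; exists V => //; split.
    by move=> i; rewrite (le_trans (Vc i)) // lee_fin.
  move=> x /XU[v vl Uvx]; exists (index v l) => //.
  by rewrite /V (nth_map v) ?index_mem // nth_index.
rewrite (nneseries_split 0 (size l)); last by move=> *; exact: diam_pow_ge0.
rewrite eseries0 ?adde0; last first.
  by move=> i hi _; rewrite V0 // /diam_pow eqxx.
rewrite add0n big_mkord (@le_trans _ _ (\sum_(i < size l) (c `^ s)%:E)) //.
  by apply: lee_sum => i _; apply: diam_pow_le.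
by rewrite sumEFin lee_fin sumr_const card_ord mulr_natl.
Qed.

(** Nearly optimal covers of the pieces, with errors [e / 2 ^ n.+1], are merged
    into one sequence by a bijection between [nat] and [nat * nat]. *)
Lemma premeasure_bigcup s delta (X : nat -> set 'rV[R]_d) :
  hausdorff_premeasure s delta (\bigcup_n X n) <=
  \sum_(0 <= n <oo) hausdorff_premeasure s delta (X n).
Proof.
have [[n noo]|hfin] := pselect (exists n, hausdorff_premeasure s delta (X n) = +oo).
  rewrite (eseries_pinfty _ _ noo) ?leey // => m _.
  by rewrite -ltNye (lt_le_trans _ (premeasure_ge0 _ _ _)).
suff h (e : R) : (0 < e)%R -> hausdorff_premeasure s delta (\bigcup_n X n) <=
    \sum_(0 <= n <oo) hausdorff_premeasure s delta (X n) + e%:E.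
  by apply/lee_addgt0Pr => e; exact: h.
move=> e0; rewrite (le_trans _ (epsilon_trick _ _ (ltW e0))) //; last first.
  by move=> n; exact: premeasure_ge0.
have /choice[G hG] : forall n, exists U : nat -> set 'rV[R]_d,
    [/\ forall i, diam (U i) <= delta%:E, X n `<=` \bigcup_i U i &
      \sum_(0 <= i <oo) diam_pow s (U i) <=
        hausdorff_premeasure s delta (X n) + (e / (2 ^ n.+1)%:R)%:E].
  move=> n; have fin : hausdorff_premeasure s delta (X n) \is a fin_num.
    rewrite ge0_fin_numE ?premeasure_ge0 // ltey; apply/eqP => h.
    by apply: hfin; exists n.
  have en : (0 < e / (2 ^ n.+1)%:R)%R by rewrite divr_gt0 // ltr0n expn_gt0.
  have [_ [U [dU XU] <-] hU] := lb_ereal_inf_adherent en fin.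
  by exists U; split => //; exact: ltW.
have /card_esym/ppcard_eqP[f] := card_nat2.
apply: (@le_trans _ _ (\sum_(0 <= n <oo) \sum_(0 <= i <oo) diam_pow s (G n i))); last first.
  apply: lee_nneseries => [n _ _|n _].
    by apply: nneseries_ge0 => *; exact: diam_pow_ge0.
  by case: (hG n).
have ge0 x : 0 <= (fun x : nat * nat => diam_pow s (G x.1 x.2)) x by exact: diam_pow_ge0.
apply: (@le_trans _ _ (\sum_(0 <= i <oo) diam_pow s (G (f i).1 (f i).2))).
  apply: ereal_inf_lbound; exists (fun i => G (f i).1 (f i).2) => //; split.
    by move=> i; case: (hG (f i).1) => hd _ _; exact: hd.
  move=> x [n _ Xx]; have [_ /(_ x Xx)[j _ Gx] _] := hG n.
  by exists (f^-1%FUN (n, j)) => //=; rewrite invK ?inE.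
have -> : \sum_(0 <= n <oo) \sum_(0 <= i <oo) diam_pow s (G n i) =
    \esum_(n in [set: nat]) \esum_(i in [set: nat]) diam_pow s (G n i).
  rewrite nneseries_esumT => [|n]; last first.
    by apply: nneseries_ge0 => *; exact: diam_pow_ge0.
  by apply: eq_esum => n _; rewrite nneseries_esumT // => i; exact: diam_pow_ge0.
rewrite nneseries_esumT // esum_esum; last by move=> *; exact: diam_pow_ge0.
rewrite (_ : setT `*`` _ = setT); last by apply/seteqP.
by rewrite (reindex_esum [set: nat] setT f).
Qed.

Lemma premeasure_set0 s delta : (0 <= s)%R -> (0 <= delta)%R ->
  hausdorff_premeasure s delta (@set0 'rV[R]_d) = 0.
Proof.
move=> s0 d0; apply/eqP; rewrite eq_le premeasure_ge0 andbT.
apply: le_trans (premeasure_finite_cover (l := [::]) (U := fun _ : nat => set0) s0 d0 _ _) _ => //.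
by rewrite mul0r.
Qed.

Lemma hausdorff_measure0 s X :
  (forall delta, (0 < delta)%R -> hausdorff_premeasure s delta X <= 0) ->
  hausdorff_measure s X = 0.
Proof.
move=> h; apply/eqP; rewrite eq_le; apply/andP; split.
  by apply: ge_ereal_sup => _ [delta d0 <-]; exact: h.
apply: (le_trans (premeasure_ge0 s 1 X)).
by apply: ereal_sup_ubound; exists 1%R => //=; exact: ltr01.
Qed.

(** The Borel-Cantelli argument: a set that is covered by every tail of a
    sequence of sets with summable premeasures is null. *)
Lemma premeasure_limsup s delta X (Y : nat -> set 'rV[R]_d) (C r : R) N :
  (0 <= r)%R -> (r < 1)%R ->
  (forall m, (N <= m)%N -> hausdorff_premeasure s delta (Y m) <= (C * r ^+ m)%:E) ->
  (forall n, X `<=` \bigcup_i Y (n + i)%N) ->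
  hausdorff_premeasure s delta X <= 0.
Proof.
move=> r0 r1 hY XY; apply/lee_addgt0Pr => e e0; rewrite add0e.
have [n Nn hn] := geometric_small (C / (1 - r)) N r0 r1 e0.
apply: le_trans (premeasure_subset _ _ (XY n)) _.
apply: le_trans (premeasure_bigcup _ _ _) _.
have hle i : hausdorff_premeasure s delta (Y (n + i)%N) <= (geometric (C * r ^+ n) r i)%:E.
  by rewrite /= -mulrA -exprD hY // (leq_trans Nn) // leq_addr.
have C0 : (0 <= C * r ^+ n)%R.
  by have := le_trans (premeasure_ge0 _ _ _) (hY n Nn); rewrite lee_fin.
apply: lime_le; first by apply: is_cvg_nneseries => *; exact: premeasure_ge0.
near=> m; apply: (@le_trans _ _ (\sum_(0 <= i < m) (geometric (C * r ^+ n) r i)%:E)).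
  by apply: lee_sum => i _; exact: hle.
rewrite sumEFin lee_fin.
rewrite (_ : (\sum_(0 <= i < m) _)%R = series (geometric (C * r ^+ n) r) m) //.
rewrite geometric_seriesE ?lt_eqF // (le_trans _ hn) //.
rewrite mulrAC ler_wpM2r ?invr_ge0 ?subr_ge0 ?(ltW r1) //.
by rewrite ler_piMr // lerBlDr lerDl exprn_ge0.
Unshelve. all: by end_near. Qed.

End Hausdorff.

(** * Upper bound for the Hausdorff dimension *)

Lemma powR_expr_inv (R : realType) (x s : R) m : 0 < x ->
  ((x ^+ m)^-1) `^ s = ((x `^ s) ^+ m)^-1.
Proof.
move=> x0; have xm : 0 < x ^+ m by rewrite exprn_gt0.
have e : (x ^+ m) `^ s = (x `^ s) ^+ m.
  by rewrite -powR_mulrn ?ltW // powRAC powR_mulrn // powR_ge0.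
rewrite -e; apply: (mulIf (lt0r_neq0 (powR_gt0 s xm))).
rewrite -powRM ?invr_ge0 ?(ltW xm) // mulVf ?gt_eqF // powR1 mulVf //.
by rewrite gt_eqF // powR_gt0.
Qed.

Section HausdorffUpper.
Variables (R : realType) (k d : nat).
Hypothesis k1 : (1 < k)%N.
Local Notation Sigma := 'rV['I_k]_d.
Variable A : buchi Sigma.
Implicit Types (w : nat -> Sigma) (q : state A).
Local Open Scope ereal_scope.

Lemma diam_prefix_le (u : seq Sigma) n : (n <= size u)%N ->
  diam [set nu R w | w in [set w | mkseq w (size u) = u]] <= (d%:R / k%:R ^+ n)%:E.
Proof.
move=> nu_; apply: diam_le => _ _ [w wu <-] [w' wu' <-].
apply: eucl_dist_nu_le => // i hi; have iu := leq_trans hi nu_.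
by rewrite -(nth_mkseq (w 0%N) w iu) -(nth_mkseq (w 0%N) w' iu) wu wu'.
Qed.

(** Every recognized point lies, for some accept state [q] and some [i], in
    infinitely many of these sets as [m] varies. *)
Let cycle_after q i m : set 'rV[R]_d :=
  [set nu R w | w in [set w | cycle_lang q (mkseq (fun l => w (i + l)%N) m)]].

Lemma cycle_after_premeasure s delta q i m : (0 <= s)%R ->
  (d%:R / k%:R ^+ m <= delta)%R ->
  hausdorff_premeasure s delta (cycle_after q i m) <=
  ((#|{: Sigma}| ^ i)%:R * (lang_count (cycle_lang q) m)%:R *
    (d%:R / k%:R ^+ m) `^ s)%:E.
Proof.
move=> s0 hdelta; pose l := [seq u ++ v | u <- words setT i, v <- words (cycle_lang q) m].
have hl u : u \in l -> size u = (i + m)%N.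
  by move=> /allpairsP[[u1 u2] [/mem_words[h1 _] /mem_words[h2 _] ->]]; rewrite size_cat h1 h2.
apply: (@le_trans _ _ ((size l)%:R * (d%:R / k%:R ^+ m) `^ s)%:E).
  apply: (@premeasure_finite_cover _ _ _ _ _ _ _ l
    (fun u => [set nu R w | w in [set w | mkseq w (size u) = u]])) => //.
    by move=> u ul; apply: diam_prefix_le; rewrite hl // leq_addl.
  move=> _ [w hw <-]; exists (mkseq w (i + m)); last by exists w; rewrite //= size_mkseq.
  apply/allpairsP; exists (mkseq w i, mkseq (fun l => w (i + l)%N) m); split.
  - by apply/mem_words; rewrite size_mkseq.
  - by apply/mem_words; rewrite size_mkseq.
  - by rewrite /mkseq iotaD map_cat add0n -[in iota i m](addn0 i) iotaDl -map_comp.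
rewrite lee_fin ler_wpM2r ?powR_ge0 // -natrM ler_nat size_allpairs !size_words.
by rewrite leq_mul2r lang_count_le orbT.
Qed.

(** For fixed [q] and [i], the premeasure of [cycle_after q i m] is of order
    [(expR t / k `^ s) ^+ m], hence summable over [m]; the points that lie in
    infinitely many of these sets form a null set, and the recognized set is
    a countable union of such null sets. *)
Lemma hausdorff_recognized_null s t : (0 <= s)%R ->
  max_entropy R (accept A) < t%:E -> (expR t < k%:R `^ s)%R ->
  hausdorff_measure s (recognized R A) = 0.
Proof.
move=> s0 ht hts; apply: hausdorff_measure0 => delta delta0.
have kR : (0 < k%:R :> R)%R by rewrite ltr0n ltnW.
have ks0 : (0 < k%:R `^ s)%R by exact: powR_gt0.
have null q i : q \in accept A ->
    hausdorff_premeasure s delta (\bigcap_n \bigcup_j cycle_after q i (n + j)) <= 0.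
  move=> qF; have [N hN] := cycle_count_le ht qF.
  have ki0 : (0 <= k%:R^-1 :> R)%R by rewrite invr_ge0 ltW.
  have ki1 : (k%:R^-1 < 1 :> R)%R by rewrite invf_lt1 // ltr1n.
  have [M _ hM] := geometric_small d%:R 0 ki0 ki1 delta0.
  apply: (@premeasure_limsup _ _ _ _ _ (cycle_after q i)
    ((#|{: Sigma}| ^ i)%:R * d%:R `^ s) (expR t / k%:R `^ s) (maxn N M)).
  - by rewrite divr_ge0 ?expR_ge0 // ltW.
  - by rewrite ltr_pdivrMr // mul1r.
  - move=> m; rewrite geq_max => /andP[Nm Mm].
    apply: le_trans (cycle_after_premeasure q i s0 _) _.
      rewrite (le_trans _ hM) // ler_wpM2l // exprVn lef_pV2 ?posrE ?exprn_gt0 //.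
      by rewrite ler_weXn2l // ler1n ltnW.
    rewrite lee_fin -!mulrA ler_wpM2l // powRM ?invr_ge0 ?exprn_ge0 ?(ltW kR) //.
    rewrite powR_expr_inv // mulrCA ler_wpM2l ?powR_ge0 // expr_div_n.
    by rewrite ler_wpM2r ?invr_ge0 ?exprn_ge0 ?powR_ge0 ?hN.
  - by move=> n x hx; have [j _ hj] := hx n I; exists j.
pose Y n := if unpickle n is Some (q, i) then
    (if q \in accept A then \bigcap_n \bigcup_j cycle_after q i (n + j) else set0)
  else set0.
have Y0 n : hausdorff_premeasure s delta (Y n) = 0.
  rewrite /Y; case: (unpickle n) => [[q i]|]; last by rewrite premeasure_set0 // ltW.
  case: ifP => qF; last by rewrite premeasure_set0 // ltW.
  by apply/eqP; rewrite eq_le premeasure_ge0 null.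
apply: (@le_trans _ _ (\sum_(0 <= n <oo) hausdorff_premeasure s delta (Y n))).
  apply: le_trans (premeasure_bigcup _ _ _); apply: premeasure_subset => x.
  move=> [_ [w <- [r [_ hr] /accepting_state[q qF hq]]]].
  have [i _ ri] := hq 0%N; exists (pickle (q, i)) => //.
  rewrite /Y pickleK qF => n _; have [j hj rj] := hq (i + n)%N.
  exists (j - i - n)%N => //; exists w => //=.
  have ij : (i <= j)%N by rewrite (leq_trans _ hj) // leq_addr.
  rewrite subnKC ?leq_subRL //.
  exact: (run_cycle hr ri rj ij).
by rewrite eseries0.
Qed.

End HausdorffUpper.

(** * Kraft's inequality *)

Section Kraft.
Variables (R : realType) (L : finType).
Hypothesis L0 : (0 < #|L|)%N.
Implicit Types (P : pred (seq L)) (u : seq L) (x : nat -> L).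

Let N : R := #|L|%:R.
Let N0 : 0 < N. Proof. by rewrite ltr0n. Qed.

(** The proportion of the extensions of [u] by [j] letters that satisfy [P], in
    a recursive form that makes its average over the next letter immediate. *)
Fixpoint proportion P j u : R :=
  if j is j'.+1 then (\sum_a proportion P j' (rcons u a)) / N else (P u)%:R.

Lemma proportion_ge0 P j u : 0 <= proportion P j u.
Proof.
elim: j u => [|j IH] u /=; first exact: ler0n.
by rewrite divr_ge0 ?sumr_ge0 // ltW.
Qed.

Lemma proportionE P j u :
  proportion P j u = #|[pred v : j.-tuple L | P (u ++ v)]|%:R / N ^+ j.
Proof.
elim: j u => [|j IH] u /=.
  rewrite expr0 divr1; congr (_%:R).
  rewrite (eq_card (B := [pred v : 0.-tuple L | P u])); last first.
    by move=> v; rewrite !inE tuple0 /= cats0.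
  case: (P u); last by rewrite eq_card0.
  by rewrite (eq_card (B := predT)) // card_tuple expn0.
rewrite (eq_bigr _ (fun a _ => IH (rcons u a))) -mulr_suml exprSr invfM mulrA.
congr (_ / _ / _); rewrite -natr_sum; congr (_%:R).
rewrite -sum1_card (reindex (fun p : L * j.-tuple L => [tuple of p.1 :: p.2])) /=.
  rewrite -(pair_big_dep xpredT (fun a (v : j.-tuple L) => P (u ++ a :: v)) (fun _ _ => 1%N)) /=.
  apply: eq_bigr => a _; rewrite -sum1_card; apply: eq_bigl => v.
  by rewrite !inE cat_rcons.
exists (fun t => (thead t, [tuple of behead t])) => [[a v] _|t _] /=.
  by congr (_, _); apply: val_inj.
by rewrite -tuple_eta.
Qed.

Variables (V : nat -> pred (seq L)) (n_ : nat -> nat).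

(** The probability that an infinite random word has a prefix of length [n_ i]
    in [V i], given that it starts with [u]. When [u] is longer than [n_ i], the
    truncated subtraction and [take] turn this into a test on [u]. *)
Let weight u i := proportion (V i) (n_ i - size u) (take (n_ i) u).

Let sum_weight u i : \sum_a weight (rcons u a) i = N * weight u i.
Proof.
rewrite /weight; have [hi|hi] := ltnP (size u) (n_ i).
  rewrite (take_oversize (ltnW hi)) -(subnSK hi) /= mulrC divfK ?gt_eqF //.
  by apply: eq_bigr => a _; rewrite size_rcons take_oversize ?size_rcons.
rewrite (eqP (hi : (n_ i - size u == 0)%N)) /=.
rewrite (eq_bigr (fun=> (V i (take (n_ i) u))%:R)) ?sumr_const ?mulr_natl //.
move=> a _; have hi' := leqW hi; rewrite size_rcons.
by rewrite (eqP (hi' : (n_ i - (size u).+1 == 0)%N)) /= -cats1 takel_cat.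
Qed.

Local Open Scope ereal_scope.

Let total u := \sum_(0 <= i <oo) (weight u i)%:E.

(** The expected number of hits is the average of its values after the next
    letter, so that some letter keeps it below [1]. *)
Let total_step u : total u < 1 -> exists a, total (rcons u a) < 1.
Proof.
move=> hu; apply: contrapT => hn; move: hu; apply/negP; rewrite -leNgt.
rewrite -(@lee_pmul2l _ N%:E) // mule1 -nneseriesZl; last first.
  by move=> i _; rewrite lee_fin proportion_ge0.
under eq_eseriesr do rewrite -EFinM -sum_weight -sumEFin.
rewrite nneseries_sum; last by move=> *; rewrite lee_fin proportion_ge0.
apply: (@le_trans _ _ (\sum_(a : L) 1)).
  by rewrite sumEFin lee_fin sumr_const.
apply: lee_sum => a _; rewrite leNgt; apply/negP => h; apply: hn.
by exists a.
Qed.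

(** Kraft's inequality for the sets of prefixes [V i] of length [n_ i] that
    meet every infinite word. If the sum were smaller than 1, then the
    expected number of hits, conditioned on a prefix, could be kept smaller
    than 1 by a suitable choice of the next letter, for ever; the infinite
    word so chosen would have no prefix in any [V i]. *)
Lemma kraft : (forall x, exists i, V i (mkseq x (n_ i))) ->
  1 <= \sum_(0 <= i <oo)
    (#|[pred v : (n_ i).-tuple L | V i (val v)]|%:R / #|L|%:R ^+ n_ i : R)%:E.
Proof.
move=> hV; rewrite leNgt; apply/negP => h.
have h0 : total [::] < 1.
  apply: le_lt_trans h; apply: lee_nneseries => [i _ _|i _].
    by rewrite lee_fin proportion_ge0.
  by rewrite lee_fin /weight subn0 proportionE.
have /choice[next hnext] : forall u, exists a, total u < 1 -> total (rcons u a) < 1.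
  move=> u; have [/total_step[a ha]|hu] := boolP (total u < 1); first by exists a.
  by have /card_gt0P[a _] := L0; exists a.
pose us := fix us n := if n is n'.+1 then rcons (us n') (next (us n')) else [::].
pose x n := next (us n).
have usE n : us n = mkseq x n by elim: n => //= n IH; rewrite mkseqS -IH.
have us1 n : total (us n) < 1 by elim: n => //= n IH; exact: hnext.
have [i Vi] := hV x.
have := us1 (n_ i); apply/negP; rewrite -leNgt.
have w0 j : 0 <= (weight (us (n_ i)) j)%:E by rewrite lee_fin proportion_ge0.
apply: le_trans (nneseries_lim_ge i.+1 (fun j _ _ => w0 j)).
rewrite big_nat_recr //=.
have -> : weight (us (n_ i)) i = 1%R.
  by rewrite /weight usE size_mkseq subnn take_oversize ?size_mkseq //= Vi.
by rewrite leeDr // sume_ge0.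
Qed.

End Kraft.

(** * Mass distribution *)

Section MassDistribution.
Variables (R : realType) (d : nat) (L : finType) (rho s : R).
Hypotheses (L0 : (0 < #|L|)%N) (rho0 : 0 < rho) (rho1 : rho < 1) (s0 : 0 <= s).
Hypothesis Lrho : 1 <= #|L|%:R * rho `^ s.
Implicit Types U : set 'rV[R]_d.

Let N0 : 0 < #|L|%:R :> R. Proof. by rewrite ltr0n. Qed.

Let Nrho n : (#|L|%:R ^+ n)^-1 <= (rho ^+ n) `^ s.
Proof.
have -> : (rho ^+ n) `^ s = (rho `^ s) ^+ n.
  by rewrite -powR_mulrn ?ltW // powRAC powR_mulrn // powR_ge0.
rewrite -exprVn lerXn2r ?nnegrE ?invr_ge0 ?powR_ge0 // ?(ltW N0) //.
by rewrite -(ler_pM2l N0) divff // gt_eqF.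
Qed.

(** The scale [rho ^+ n] assigned to [U] is the smallest one above the diameter,
    which costs a factor [#|L|]. For a set of diameter zero any scale is
    admissible, and one whose mass is below [e] is chosen. *)
Lemma scale_of_diam U (e : R) : (diam U <= 1%:E)%E -> 0 < e ->
  exists n, (diam U <= (rho ^+ n)%:E)%E /\ (U !=set0 ->
    ((#|L|%:R ^+ n)^-1%:E <= #|L|%:R%:E * diam_pow s U + e%:E)%E).
Proof.
move=> dU e0; have [[y Uy]|U0] := pselect (U !=set0); last first.
  by exists 0%N; rewrite expr0; split.
have N1 : 1 <= #|L|%:R :> R by rewrite ler1n.
have : diam_pow s U = poweR (diam U) s.
  by rewrite /diam_pow; case: eqP => // hU; move: Uy; rewrite hU.
have := diam_ge0 Uy; case: (diam U) dU => [r| |] //; rewrite !lee_fin => r1.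
rewrite le_eqVlt => /orP[/eqP <-|r0] ->; last first.
  have ex : exists n, rho ^+ n.+1 < r.
    have [|n _] := geometric_small 1 0 (ltW rho0) rho1 (e := r / 2).
      by rewrite divr_gt0.
    rewrite mul1r => h; exists n; rewrite exprS.
    apply: (@le_lt_trans _ _ (rho ^+ n)); first by rewrite ler_piMl ?exprn_ge0 // ltW.
    by apply: le_lt_trans h _; rewrite ltr_pdivrMr // ltr_pMr // ltr1n.
  case: (ex_minnP ex) => n hn nmin; exists n; split.
    rewrite lee_fin; case: n nmin {hn} => [|n] nmin; first by rewrite expr0.
    by rewrite leNgt; apply/negP => /nmin; rewrite ltnn.
  move=> _; rewrite poweR_EFin -EFinM -EFinD lee_fin.
  rewrite (@le_trans _ _ (#|L|%:R * r `^ s)) ?lerDl ?(ltW e0) //.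
  rewrite mulrC -ler_pdivrMr // -invfM -exprSr (le_trans (Nrho _)) //.
  by rewrite ge0_ler_powR // ?nnegrE ?exprn_ge0 // ltW.
have [s00|s00] := eqVneq s 0.
  exists 0%N; rewrite expr0 invr1; split; first by rewrite lee_fin.
  by move=> _; rewrite poweR_EFin s00 powRr0 mule1 -EFinD lee_fin (le_trans N1) ?lerDl ?ltW.
have sp : 0 < s by rewrite lt0r s00.
have rs1 : rho `^ s < 1.
  have e1 : 1 `^ s = 1 :> R by rewrite powR1.
  by rewrite -[ltRHS]e1 gt0_ltr_powR // nnegrE ltW.
have Ni1 : #|L|%:R^-1 < 1 :> R.
  by rewrite (le_lt_trans _ rs1) //; have := Nrho 1; rewrite !expr1.
have Ni0 : 0 <= #|L|%:R^-1 :> R by rewrite invr_ge0 ltW.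
have [n _ hn] := geometric_small 1 0 Ni0 Ni1 e0.
exists n; split; first by rewrite lee_fin exprn_ge0 // ltW.
move=> _; rewrite poweR_EFin -EFinM -EFinD lee_fin.
rewrite mul1r exprVn in hn; rewrite (le_trans hn) // lerDr mulr_ge0 ?powR_ge0 //.
Qed.

(** The mass distribution principle for the image of the infinite words over
    [L], where a prefix of length [n] carries mass [#|L| ^- n] and where a set
    of diameter at most [rho ^ n] meets boundedly many prefixes of length [n].
    The mass itself is hidden in Kraft's inequality. *)
Lemma mass_distribution (f : (nat -> L) -> 'rV[R]_d) (M : nat) (X : set 'rV[R]_d) :
  (forall x, X (f x)) ->
  (forall n U, (diam U <= (rho ^+ n)%:E)%E ->
    (#|[set v : n.-tuple L | `[< exists2 x, mkseq x n = val v & U (f x) >]]%SET| <= M)%N) ->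
  (0 < hausdorff_measure s X)%E.
Proof.
move=> Xf hM; pose M' : R := M.+1%:R; have M0 : 0 < M' by rewrite ltr0n.
(* [c] and [e] are such that [M' * (#|L| * c + e) = 1], the value at which the
   total mass of the cover would reach Kraft's bound. *)
pose c : R := (2 * M' * #|L|%:R)^-1.
have c0 : 0 < c by rewrite invr_gt0 !mulr_gt0.
apply: (@lt_le_trans _ _ (hausdorff_premeasure s 1 X)); last first.
  by apply: ereal_sup_ubound; exists 1 => //=; exact: ltr01.
apply: (@lt_le_trans _ _ c%:E); first by rewrite lte_fin.
apply: le_ereal_inf_tmp => _ [U [dU XU] <-].
pose e : R := (2 * M')^-1; have e0 : 0 < e by rewrite invr_gt0 mulr_gt0.
have e2 i : 0 < e / (2 ^ i.+1)%:R by rewrite divr_gt0 // ltr0n expn_gt0.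
have /choice[n_ hn_] := fun i => scale_of_diam (dU i) (e2 i).
pose V i : pred (seq L) := fun u => `[< exists2 x, mkseq x (n_ i) = u & U i (f x) >].
have VU x : exists i, V i (mkseq x (n_ i)).
  have [i _ Ux] := XU _ (Xf x).
  by exists i; apply/asboolP; exists x.
have term i : (((#|[pred v : (n_ i).-tuple L | V i (val v)]|%:R / #|L|%:R ^+ n_ i : R)%:E) <=
    M'%:E * (#|L|%:R%:E * diam_pow s (U i) + (e / (2 ^ i.+1)%:R)%:E))%E.
  have [dn hn] := hn_ i.
  have [U0|U0] := pselect (U i !=set0); last first.
    rewrite eq_card0; last first.
      move=> v; apply/negP => /asboolP[x _ Ux]; apply: U0.
      by exists (f x).
    rewrite mul0r mule_ge0 ?lee_fin ?(ltW M0) // adde_ge0 ?lee_fin ?(ltW (e2 i)) //.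
    by rewrite mule_ge0 ?lee_fin ?(ltW N0) ?diam_pow_ge0.
  rewrite EFinM; apply: (@le_trans _ _ (M'%:E * ((#|L|%:R ^+ n_ i)^-1)%:E)%E).
    rewrite -!EFinM lee_fin ler_wpM2r ?invr_ge0 ?exprn_ge0 ?(ltW N0) //.
    rewrite ler_nat ltnW // ltnS (leq_trans _ (hM _ _ dn)) //.
    by apply: eq_leq; apply: eq_card => v; rewrite !inE.
  by rewrite lee_pmul2l // ?lte_fin //; exact: hn.
have K1 := kraft R L0 VU.
have {}K1 : (1 <= M'%:E * (#|L|%:R%:E * \sum_(0 <= i <oo) diam_pow s (U i) + e%:E))%E.
  apply: le_trans K1 _; apply: le_trans (lee_nneseries _ (fun i _ => term i)) _.
    by move=> i _ _; rewrite lee_fin divr_ge0 // exprn_ge0.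
  rewrite nneseriesZl; last first.
    move=> i _; rewrite adde_ge0 ?lee_fin ?(ltW (e2 i)) //.
    by rewrite mule_ge0 ?lee_fin ?(ltW N0) ?diam_pow_ge0.
  rewrite lee_pmul2l ?lte_fin //.
  apply: le_trans (epsilon_trick _ _ (ltW e0)) _.
    by move=> i; rewrite mule_ge0 ?lee_fin ?(ltW N0) ?diam_pow_ge0.
  by rewrite nneseriesZl // => i _; exact: diam_pow_ge0.
have : (0 <= \sum_(0 <= i <oo) diam_pow s (U i))%E.
  by apply: nneseries_ge0 => *; exact: diam_pow_ge0.
case: (\sum_(0 <= i <oo) _)%E K1 => [S| |] //; rewrite ?leey // => K1 S0.
have {}K1 : 1 <= M' * (#|L|%:R * S + e) by rewrite -lee_fin EFinM EFinD EFinM.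
move: K1; rewrite lee_fin mulrDr.
have -> : M' * e = 2^-1 by rewrite /e invfM mulrCA divff ?mulr1 // gt_eqF.
move=> K1; rewrite /c -[leLHS]mul1r ler_pdivrMr ?mulr_gt0 //.
have -> : S * (2 * M' * #|L|%:R) = 2 * (M' * (#|L|%:R * S)) by ring.
lra.
Qed.

End MassDistribution.

(** * Blocks of cycles and the lower bound for the Hausdorff dimension *)

Section Blocks.
Variables (Sigma : finType) (A : buchi Sigma).
Variables (q : state A) (m : nat).

Definition block := {v : m.-tuple Sigma | `[< cycle_lang q (val v) >]}.

Lemma card_block : #|{: block}| = lang_count (cycle_lang q) m.
Proof. by rewrite card_sig. Qed.

Definition block_word (u : seq Sigma) (t : seq block) : seq Sigma :=
  u ++ flatten [seq tval (val b) | b <- t].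

Lemma shape_blocks (t : seq block) :
  shape [seq tval (val b) | b <- t] = nseq (size t) m.
Proof. by elim: t => //= b t ->; rewrite size_tuple. Qed.

Lemma size_block_word u t : size (block_word u t) = (size u + size t * m)%N.
Proof. by rewrite size_cat size_flatten shape_blocks sumn_nseq mulnC. Qed.

Lemma block_word_inj u t t' : size t = size t' ->
  block_word u t = block_word u t' -> t = t'.
Proof.
move=> st /eqP; rewrite eqseq_cat // eqxx => /eqP e.
apply: (inj_map (f := fun b : block => tval (val b))).
  by move=> b b' /val_inj /val_inj.
by apply: eq_from_flatten_shape; rewrite ?shape_blocks ?st.
Qed.

Lemma block_word_nth_inj u a0 n (t t' : n.-tuple block) :
  (forall i, (i < size u + n * m)%N ->
    nth a0 (block_word u t) i = nth a0 (block_word u t') i) -> t = t'.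
Proof.
move=> h; apply: val_inj; apply: (@block_word_inj u); first by rewrite !size_tuple.
apply: (@eq_from_nth _ a0); first by rewrite !size_block_word !size_tuple.
by move=> i; rewrite size_block_word size_tuple; exact: h.
Qed.

Lemma block_walk (b : block) : exists z,
  [/\ walk q z, target q z = q & unzip1 z = tval (val b)].
Proof. by apply/cycle_langP/asboolP; exact: (valP b). Qed.

End Blocks.

Section HausdorffLower.
Variables (R : realType) (k d : nat).
Hypothesis k1 : (1 < k)%N.
Local Notation Sigma := 'rV['I_k]_d.
Variable A : buchi Sigma.
Hypothesis Atrim : trim A.

(** The initial walk to [q] may be empty, so it is glued to the first block:
    therefore the description of the prefixes starts at [n = 1]. *)
Lemma accepts_blocks q m a0 : q \in accept A -> (0 < m)%N ->
  exists u, forall x : nat -> block q m, exists w, accepts A w /\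
    forall n i, (i < size u + n * m)%N -> (0 < n)%N ->
      w i = nth a0 (block_word u (mkseq x n)) i.
Proof.
move=> qF m0; have [z0 [p [hp hz0 tz0]]] := trim_reach Atrim q.
have [blk hblk] := choice (@block_walk Sigma A q m).
exists (unzip1 z0) => x.
pose Z n := (if n is 0 then z0 else [::]) ++ blk (x n).
pose s n := if n is 0 then p else q.
have blkn0 b : blk b != [::].
  have [_ _ hb] := hblk b; rewrite -size_eq0 -(size_map fst) -/(unzip1 _) hb.
  by rewrite size_tuple -lt0n.
have [|||||w hw hwn] := @concat_accepts Sigma A Z s a0 => //.
- by move=> n; have [h1 _ _] := hblk (x n); case: n h1 => [|n] h1;
    rewrite /Z walk_cat /= ?hz0 ?tz0.
- by move=> n; have [_ h2 _] := hblk (x n); case: n h2 => [|n] h2;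
    rewrite /Z target_cat /= ?tz0.
- by move=> n; rewrite /Z -size_eq0 size_cat addn_eq0 negb_and !size_eq0 blkn0 orbT.
have ZE n : unzip1 (concat Z n.+1) = block_word (unzip1 z0) (mkseq x n.+1).
  elim: n => [|n IH].
    rewrite /concat /= cats0 /unzip1 map_cat /block_word /= cats0.
    by case: (hblk (x 0%N)) => _ _ <-.
  rewrite concatS /unzip1 map_cat -/unzip1 -/(unzip1 _) IH (mkseqS x n.+1) /block_word.
  rewrite map_rcons flatten_rcons catA.
  by have [_ _ hb] := hblk (x n.+1); rewrite -hb.
exists w; split=> // -[//|n] i hi _.
have hs : (i < size (concat Z n.+1))%N.
  by rewrite -(size_map fst) -/(unzip1 _) ZE size_block_word size_mkseq.
by rewrite (hwn _ _ hs) ZE.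
Qed.

(** With [N] blocks of length [m] the Cantor set of all block sequences has
    contraction ratio [k ^- m], and [k `^ s <= expR t] together with
    [expR t ^+ m < N] is what the mass distribution principle asks for. The
    initial word [u] shifts the scale by [size u], whence the constant
    [k ^ size u]. *)
Lemma hausdorff_recognized_gt0 s t : 0 <= s ->
  (t%:E < max_entropy R (accept A))%E -> k%:R `^ s <= expR t ->
  (0 < hausdorff_measure s (recognized R A))%E.
Proof.
move=> s0 ht hts.
have kR : 0 < k%:R :> R by rewrite ltr0n ltnW.
have [q [m [qF m0 hm]]] := cycle_count_gt 0 ht.
rewrite -card_block in hm.
have L0 : (0 < #|{: block q m}|)%N.
  by rewrite -(ltr_nat R); apply: le_lt_trans hm; rewrite exprn_ge0 ?expR_ge0.
have /card_gt0P[b0 _] := L0; pose a0 := tnth (val b0) (Ordinal m0).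
have [u /choice[g hg]] := @accepts_blocks q m a0 qF m0.
apply: (@mass_distribution _ _ (block q m) ((k%:R ^+ m)^-1) s L0 _ _ s0 _
  (fun x => nu R (g x)) ((2 * k ^ size u + 3) ^ d)).
- by rewrite invr_gt0 exprn_gt0.
- by rewrite invf_lt1 ?exprn_gt0 // exprn_egt1 ?ltr1n // -lt0n.
- rewrite powR_expr_inv // ler_pdivlMr ?exprn_gt0 ?powR_gt0 // mul1r.
  by rewrite (le_trans _ (ltW hm)) // lerXn2r // nnegrE ?powR_ge0 ?expR_ge0.
- by move=> x; split; [exact: nu_unit_cube|exists (g x) => //; case: (hg x)].
move=> n U dU; set V := [set v | _]%SET.
(* [y v] is an extension of [v] whose value lies in [U]. *)
have /choice[y hy] : forall v : n.-tuple (block q m), exists x : nat -> block q m,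
    v \in V -> mkseq x n = v /\ U (nu R (g x)).
  move=> v; have [|vV] := boolP (v \in V); last by exists (fun=> b0).
  by rewrite inE => /asboolP[x h1 h2]; exists x.
apply: (few_prefixes k1 (g := fun v => g (y v)) (U := U) (n := size u + n * m)).
- by move=> v /hy[].
- rewrite natrX (le_trans dU) // lee_fin exprD invfM mulrA divff ?gt_eqF ?exprn_gt0 //.
  by rewrite mul1r exprVn -exprM mulnC.
- move=> v v' vV v'V h; have [n0|n0] := posnP n.
    have nil (b : n.-tuple (block q m)) : tval b = [::].
      by apply: size0nil; rewrite size_tuple.
    by apply: val_inj; rewrite /= !nil.
  have [h1 _] := hy v vV; have [h2 _] := hy v' v'V.
  apply: (@block_word_nth_inj _ _ q m u a0) => i hi.
  have [_ g1] := hg (y v); have [_ g2] := hg (y v').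
  by rewrite -h1 -h2 -(g1 _ _ hi) // -(g2 _ _ hi) // h.
Qed.

End HausdorffLower.

(** * Box-counting dimension *)

Lemma exp_scale (R : realType) (b y : R) : 1 < b -> 1 <= y ->
  exists n, b ^+ n <= y < b ^+ n.+1.
Proof.
move=> b1 y1; have b0 : 0 < b by exact: lt_trans b1.
have y0 : 0 < y by exact: lt_le_trans y1.
have ex : exists n, y < b ^+ n.+1.
  have bi0 : 0 <= b^-1 by rewrite invr_ge0 ltW.
  have bi1 : b^-1 < 1 by rewrite invf_lt1.
  have [|n _] := geometric_small 1 0 bi0 bi1 (e := y^-1); first by rewrite invr_gt0.
  rewrite mul1r exprVn lef_pV2 ?posrE ?exprn_gt0 // => hn; exists n.
  by rewrite (le_lt_trans hn) // exprS ltr_pMl // exprn_gt0.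
case: (ex_minnP ex) => n hn nmin; exists n; rewrite hn andbT.
case: n nmin {hn} => [|n] nmin; first by rewrite expr0.
by rewrite leNgt; apply/negP => /nmin; rewrite ltnn.
Qed.

Lemma lne_homo (R : realType) (x y : \bar R) :
  (0 <= x -> x <= y -> lne x <= lne y)%E.
Proof.
move=> x0 xy; rewrite lee_lne // in_itv /= leey andbT //.
exact: le_trans xy.
Qed.

Section BoxDimension.
Variables (R : realType) (d : nat).
Implicit Types (X U : set 'rV[R]_d) (e : R).
Local Open Scope ereal_scope.

Lemma covering_number_le X e (T : eqType) (l : seq T) (U : T -> set 'rV[R]_d) :
  (forall v, v \in l -> diam (U v) <= e%:E) ->
  (forall x, X x -> exists2 v, v \in l & U v x) ->
  covering_number X e <= (size l)%:R%:E.
Proof.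
move=> dU XU; apply: ereal_inf_lbound; exists (size l) => //.
exists (fun i => U (tnth (in_tuple l) i)); split=> [i|x /XU[v vl Uv]].
  by apply: dU; exact: mem_tnth.
by have /tnthP[i vE] : v \in in_tuple l by []; exists i => //; rewrite -vE.
Qed.

(** Double counting of the pairs of a point [f t] and a set of the cover that
    contains it. *)
Lemma covering_number_ge X e (T : finType) (f : T -> 'rV[R]_d) (M : nat) :
  (0 < M)%N -> (forall t, X (f t)) ->
  (forall U, diam U <= e%:E -> (#|[set t | `[< U (f t) >]]%SET| <= M)%N) ->
  (#|T|%:R / M%:R)%:E <= covering_number X e.
Proof.
move=> M0 Xf hM; apply: le_ereal_inf_tmp => _ [n [U [dU XU]] <-].
rewrite lee_fin ler_pdivrMr ?ltr0n // -natrM ler_nat.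
apply: (@leq_trans (\sum_(i < n) #|[set t | `[< U i (f t) >]]%SET|)); last first.
  rewrite -[X in (_ <= X * _)%N]card_ord -sum_nat_const.
  by apply: leq_sum => i _; exact: hM.
under eq_bigr do rewrite -sum1_card big_mkcond.
rewrite exchange_big -sum1_card; apply: leq_sum => t _.
have [i _ Ut] := XU _ (Xf t).
rewrite (bigD1 i) //= (_ : t \in _); last by rewrite inE; apply/asboolP.
exact: leq_addr.
Qed.

Lemma covering_number_ge0 X e : 0 <= covering_number X e.
Proof. by apply: le_ereal_inf_tmp => _ [n _ <-]; rewrite lee_fin. Qed.

(** The additive constants [D] disappear after division by [ln e^-1], and only
    then does [t] tend to [h]. *)
Lemma has_box_dim_of_bounds X (h l : R) : (0 < l)%R ->
  (forall t, (h < t)%R -> exists D : R, forall e, (0 < e < 1)%R ->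
     lne (covering_number X e) <= (t / l * ln e^-1 + D)%:E) ->
  (forall t, (t < h)%R -> exists D : R, forall e, (0 < e < 1)%R ->
     (t / l * ln e^-1 - D)%:E <= lne (covering_number X e)) ->
  has_box_dim X (h / l)%:E.
Proof.
move=> l0 hU hL.
pose F e := lne (covering_number X e) * ((ln e^-1)^-1)%:E.
have key (eps : R) : (0 < eps)%R -> \forall e \near (0 : R)^'+,
    exists2 r : R, F e = r%:E & (`|h / l - r| <= eps)%R.
  (* One half of [eps] is spent on [t], the other on [D / ln e^-1]. *)
  move=> eps0; have el0 : (0 < eps * l / 2)%R by rewrite !(divr_gt0, mulr_gt0).
  have [|D1 h1] := hU (h + eps * l / 2)%R; first by rewrite ltrDl.
  have [|D2 h2] := hL (h - eps * l / 2)%R; first by rewrite ltrBlDr ltrDl.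
  pose B : R := (1 + `|2 * D1 / eps| + `|2 * D2 / eps|)%R.
  near=> e.
  have e0 : (0 < e)%R by near: e; exact: nbhs_right_gt.
  have eB : (e < expR (- B))%R by near: e; apply: nbhs_right_lt; exact: expR_gt0.
  have B1 : (1 <= B)%R by rewrite /B -addrA lerDl addr_ge0.
  have e1 : (0 < e < 1)%R.
    rewrite e0 (lt_le_trans eB) // -expR0 ler_expR oppr_le0.
    by rewrite (le_trans _ B1).
  move: (h1 e e1) (h2 e e1); rewrite /F; set lam := ln _.
  have lamB : (B < lam)%R.
    rewrite /lam lnV ?posrE // ltrNr -ltr_expR lnK ?posrE //.
  have lam0 : (0 < lam)%R by rewrite (lt_trans _ lamB) // (lt_le_trans _ B1).
  have hD1 : (2 * D1 / eps <= lam)%R.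
    rewrite (le_trans (ler_norm _)) // (le_trans _ (ltW lamB)) //.
    by rewrite /B addrAC lerDr addr_ge0.
  have hD2 : (2 * D2 / eps <= lam)%R.
    rewrite (le_trans (ler_norm _)) // (le_trans _ (ltW lamB)) //.
    by rewrite /B lerDr addr_ge0.
  case: (lne _) => [r| |] //; rewrite !lee_fin => r1 r2.
  exists (r / lam)%R => //.
  have E c : ((h + c * (eps * l / 2)) / l = h / l + c * (eps / 2))%R.
    by field; rewrite gt_eqF.
  have := E 1%R; rewrite !mul1r => E1; rewrite E1 in r1.
  have := E (-1)%R; rewrite !mulN1r => E2; rewrite E2 in r2.
  rewrite ler_pdivrMr // in hD1; rewrite ler_pdivrMr // in hD2.
  rewrite ler_norml; apply/andP; split.
    rewrite lerNl opprB lerBlDr ler_pdivrMr //; nra.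
  rewrite lerBlDr -lerBlDl ler_pdivlMr //; nra.
rewrite /has_box_dim; apply/fine_cvgP; split.
  have := key 1%R ltr01; apply: filterS => e [r Fr _].
  by rewrite -/(F e) Fr.
apply/cvgrPdist_le => eps /key; apply: filterS => e [r Fr hr].
by rewrite /= -/(F e) Fr.
Unshelve. all: by end_near. Qed.

End BoxDimension.

Section BoxRecognized.
Variables (R : realType) (k d : nat).
Hypotheses (k1 : (1 < k)%N) (d1 : (1 <= d)%N).
Local Notation Sigma := 'rV['I_k]_d.
Variable A : buchi Sigma.
Hypothesis Atrim : trim A.

Let kR : 1 < k%:R :> R. Proof. by rewrite ltr1n. Qed.
Let kR0 : 0 < k%:R :> R. Proof. by rewrite ltr0n ltnW. Qed.
Let lnk0 : 0 < ln k%:R :> R. Proof. exact: ln_gt0. Qed.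

Lemma accepts_prefix (w : nat -> Sigma) n : accepts A w -> prefix_lang A (mkseq w n).
Proof.
move=> [r [r0 hr] _].
have [i|z [hz _ hw]] := @run_walk Sigma A r (mkseq w n).
  have hi : (i < n)%N by have := ltn_ord i; rewrite [X in (_ < X)%N]size_mkseq.
  by rewrite (tnth_nth (w 0%N)) /= nth_mkseq.
by exists (r 0%N), z.
Qed.

Lemma covering_recognized_le n e : d%:R / k%:R ^+ n <= e ->
  (covering_number (recognized R A) e <= (lang_count (prefix_lang A) n)%:R%:E)%E.
Proof.
move=> hn; rewrite -size_words.
apply: (covering_number_le
  (U := fun u => [set nu R w | w in [set w | mkseq w (size u) = u]])).
  move=> u /mem_words[su _]; apply: (le_trans (diam_prefix_le R k1 (n := n) _)).
    by rewrite su.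
  by rewrite lee_fin.
move=> _ [_ [w <- wA]]; exists (mkseq w n).
  by apply/mem_words; rewrite size_mkseq; split=> //; exact: accepts_prefix.
by exists w; rewrite //= size_mkseq.
Qed.

(** For [k ^ n <= d / e < k ^ n.+1] the cubes of the prefixes of length [n.+1]
    have diameter at most [e]. *)
Lemma covering_recognized_upper (h t : R) :
  max_entropy R [set: state A]%SET = h%:E -> 0 <= h -> h < t ->
  exists D : R, forall e, 0 < e < 1 ->
    (lne (covering_number (recognized R A) e) <= (t / ln k%:R * ln e^-1 + D)%:E)%E.
Proof.
move=> hh h0 ht; have t0 : 0 < t by exact: le_lt_trans ht.
pose t' := (h + t) / 2; have [ht' tt'] : h < t' /\ t' < t by rewrite /t'; split; lra.
have [C hC] : exists C : R, forall n,
    (lang_count (prefix_lang A) n)%:R <= C * expR t ^+ n.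
  apply: (@prefix_count_le _ _ _ (expR t')); rewrite ?expR_ge0 ?ltr_expR // => q.
  apply: cycle_count_le_const; last by rewrite hh lte_fin.
  by rewrite (le_trans h0) // ltW.
pose C' := Num.max 1 C; have C'0 : 0 < C' by rewrite lt_max ltr01.
exists (ln C' + t * (ln d%:R / ln k%:R + 1)) => e /andP[e0 e1].
have d0 : 1 <= d%:R :> R by rewrite ler1n.
have y1 : 1 <= d%:R / e by rewrite ler_pdivlMr // mul1r (le_trans (ltW e1)).
have [n /andP[n1 n2]] := exp_scale kR y1.
have hn : d%:R / k%:R ^+ n.+1 <= e.
  by rewrite ler_pdivrMr ?exprn_gt0 // mulrC -ler_pdivrMr // ltW.
apply: (@le_trans _ _ (lne (C' * expR t ^+ n.+1)%:E)).
  apply: lne_homo; first exact: covering_number_ge0.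
  apply: le_trans (covering_recognized_le hn) _; rewrite lee_fin (le_trans (hC _)) //.
  by rewrite ler_wpM2r ?exprn_ge0 ?expR_ge0 // le_max lexx orbT.
have E0 : 0 < expR t ^+ n.+1 by rewrite exprn_gt0 ?expR_gt0.
rewrite lne_EFin ?mulr_gt0 // lee_fin lnM ?posrE // addrCA lerD2l.
rewrite -expRM_natl expRK.
have hln : n%:R * ln k%:R <= ln d%:R + ln e^-1.
  rewrite -lnM ?posrE ?invr_gt0 ?(lt_le_trans _ d0) // mulr_natl -lnXn //.
  by rewrite ler_ln ?posrE ?exprn_gt0 // (lt_le_trans _ y1).
rewrite -ler_pdivlMr // mulrDl in hln.
have -> : t / ln k%:R * ln e^-1 + t * (ln d%:R / ln k%:R + 1) =
    (ln d%:R / ln k%:R + ln e^-1 / ln k%:R + 1) * t by ring.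
by rewrite ler_pM2r // -natr1 lerD2r.
Qed.

Lemma accepts_block_prefix (q : state A) m a0 : exists u, forall t : seq (block q m),
  exists w, accepts A w /\ forall i, (i < size (block_word u t))%N ->
    w i = nth a0 (block_word u t) i.
Proof.
have [z0 [p [hp hz0 tz0]]] := trim_reach Atrim q.
have [blk hblk] := choice (@block_walk Sigma A q m).
exists (unzip1 z0) => t.
have [z [hz tz uz]] : exists z, [/\ walk q z, target q z = q &
    unzip1 z = flatten [seq tval (val b) | b <- t]].
  elim: t => [|b t [z [hz tz uz]]]; first by exists [::].
  have [h1 h2 h3] := hblk b; exists (blk b ++ z).
  by rewrite walk_cat target_cat h1 h2 hz tz /unzip1 map_cat -!/(unzip1 _) h3 uz.
have hzz : walk p (z0 ++ z) by rewrite walk_cat hz0 tz0.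
have [w hw hwi] := trim_extend Atrim a0 hp hzz.
have E : block_word (unzip1 z0) t = unzip1 (z0 ++ z).
  by rewrite /block_word -uz /unzip1 map_cat.
by exists w; split=> // i; rewrite E size_map; exact: hwi.
Qed.

Lemma covering_recognized_ge1 e : (1%:E <= covering_number (recognized R A) e)%E.
Proof.
have [q _ _] := accepting_cycle Atrim.
have [a0 _] : exists a : Sigma, True.
  by case: (trim_accept Atrim q) => [[|[a p] z] [//]]; exists a.
have [u hu] := accepts_block_prefix q 0 a0; have [w [wA _]] := hu [::].
have := @covering_number_ge R d (recognized R A) e unit (fun=> nu R w) 1.
rewrite card_unit divr1; apply=> // [_|U _]; last by rewrite (leq_trans (max_card _)) ?card_unit.
by split; [exact: nu_unit_cube|exists w].
Qed.

(** For [(k ^ m) ^ n <= e^-1] the sequences of [n] blocks yield points of which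
    boundedly many lie in a set of diameter [e]. A negative [t] is compared with
    the trivial bound [1] on the covering number. *)
Lemma covering_recognized_lower (h t : R) :
  max_entropy R [set: state A]%SET = h%:E -> t < h ->
  exists D : R, forall e, 0 < e < 1 ->
    ((t / ln k%:R * ln e^-1 - D)%:E <= lne (covering_number (recognized R A) e))%E.
Proof.
move=> hh ht; have [tneg|t0] := ltP t 0.
  exists 0 => e /andP[e0 e1]; apply: (@le_trans _ _ 0%E).
    rewrite lee_fin subr0 mulr_le0_ge0 //.
      by rewrite mulr_le0_ge0 ?(ltW tneg) // invr_ge0 ltW.
    by rewrite ln_ge0 // invf_ge1 // ltW.
  by rewrite lne_ge0 covering_recognized_ge1.
have : (t%:E < max_entropy R [set: state A]%SET)%E by rewrite hh lte_fin.
move=> /(cycle_count_gt 0)[q [m [_ m0 hm]]].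
rewrite -card_block in hm.
have L0 : (0 < #|{: block q m}|)%N.
  by rewrite -(ltr_nat R); apply: le_lt_trans hm; rewrite exprn_ge0 ?expR_ge0.
have /card_gt0P[b0 _] := L0; pose a0 := tnth (val b0) (Ordinal m0).
have [u /choice[g hg]] := accepts_block_prefix q m a0.
pose M := ((2 * k ^ size u + 3) ^ d)%N.
have M0 : (0 < M)%N by rewrite expn_gt0 addn3.
have MR : 0 < M%:R :> R by rewrite ltr0n.
exists (t * m%:R + ln M%:R) => e /andP[e0 e1].
have km1 : 1 < k%:R ^+ m :> R by rewrite exprn_egt1 // -lt0n.
have y1 : 1 <= e^-1 by rewrite invf_ge1 // ltW.
have [n /andP[n1 n2]] := exp_scale km1 y1.
have kmn0 : 0 < (k%:R ^+ m) ^+ n :> R by rewrite exprn_gt0 // exprn_gt0.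
have cov : ((#|{: n.-tuple (block q m)}|%:R / M%:R)%:E <=
    covering_number (recognized R A) e)%E.
  apply: (covering_number_ge (f := fun v : n.-tuple (block q m) => nu R (g v)) M0)
    => [v|U dU].
    by split; [exact: nu_unit_cube|exists (g v) => //; case: (hg v)].
  apply: (few_prefixes k1 (g := fun v : n.-tuple (block q m) => g v) (U := U)
    (n := size u + n * m)).
  - by move=> v; rewrite inE => /asboolP.
  - rewrite natrX (le_trans dU) // lee_fin exprD invfM mulrA divff ?gt_eqF ?exprn_gt0 //.
    by rewrite mul1r mulnC exprM -[leLHS]invrK lef_pV2 ?posrE // invr_gt0.
  - move=> v v' _ _ hv; apply: (@block_word_nth_inj _ _ q m u a0) => i hi.
    have [_ g1] := hg v; have [_ g2] := hg v'.
    by rewrite -(g1 i) ?size_block_word ?size_tuple // -(g2 i)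
      ?size_block_word ?size_tuple // hv.
have N0 : 0 < #|{: block q m}|%:R :> R by rewrite ltr0n.
apply: le_trans (lne_homo _ cov); last by rewrite lee_fin divr_ge0.
rewrite card_tuple natrX lne_EFin ?divr_gt0 ?exprn_gt0 // lee_fin.
rewrite ln_div ?posrE ?exprn_gt0 // lnXn // -[ln _ *+ _]mulr_natl.
have lnN : m%:R * t <= ln #|{: block q m}|%:R.
  by rewrite -ler_expR lnK ?posrE // expRM_natl ltW.
have lnE : ln e^-1 <= n.+1%:R * (m%:R * ln k%:R).
  rewrite !mulr_natl -lnXn // -lnXn ?exprn_gt0 // ler_ln ?posrE ?invr_gt0 ?ltW //.
  by rewrite exprn_gt0 // exprn_gt0.
have h1 : t / ln k%:R * ln e^-1 <= t * (n.+1%:R * m%:R).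
  by rewrite -mulrA ler_wpM2l // mulrC ler_pdivrMr // -mulrA.
have h2 : n%:R * (m%:R * t) <= n%:R * ln #|{: block q m}|%:R by rewrite ler_wpM2l.
by rewrite -natr1 in h1; lra.
Qed.

End BoxRecognized.

(** * The dimensions of the recognized set *)

Theorem theoremB (R : realType) (k d : nat) (hk : (2 <= k)%N) (hd : (1 <= d)%N)
    (A : buchi 'rV['I_k]_d) (hA : trim A) :
  hausdorff_dim (recognized R A) =
    (((ln k%:R)^-1)%:E * max_entropy R (accept A))%E /\
  has_box_dim (recognized R A)
    (((ln k%:R)^-1)%:E * max_entropy R [set: state A])%E.
Proof.
have lnk0 : 0 < ln k%:R :> R by rewrite ln_gt0 // ltr1n.
have kR0 : 0 < k%:R :> R by rewrite ltr0n ltnW.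
split.
  have [h hE h0] := max_entropy_fin R hA (fun q (qF : q \in accept A) => qF).
  have powE s : k%:R `^ s = expR (s * ln k%:R) :> R by rewrite /powR gt_eqF.
  rewrite hE -EFinM; apply/eqP; rewrite eq_le; apply/andP; split.
    apply/lee_addgt0Pr => e e0; apply: ereal_inf_lbound.
    have s0 : 0 <= (ln k%:R)^-1 * h by rewrite mulr_ge0 // invr_ge0 ltW.
    exists ((ln k%:R)^-1 * h + e) => //; split; first by rewrite addr_ge0 // ltW.
    (* The exponent lies half-way between [h] and [s * ln k]. *)
    apply: (@hausdorff_recognized_null R k d hk A _ (h + e * ln k%:R / 2)).
    - by rewrite addr_ge0 // ltW.
    - by rewrite hE lte_fin ltrDl !mulr_gt0 // invr_gt0.
    - rewrite powE ltr_expR mulrDl [_^-1 * h]mulrC divfK ?gt_eqF // ltrD2l.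
      by rewrite ltr_pdivrMr // ltr_pMr ?mulr_gt0 // ltr1n.
  apply: le_ereal_inf_tmp => _ [s [s0 hs] <-]; rewrite leNgt lte_fin.
  apply/negP => sh.
  have : (0 < hausdorff_measure s (recognized R A))%E.
    apply: (@hausdorff_recognized_gt0 R k d hk A hA s (s * ln k%:R)) => //.
      by rewrite hE lte_fin -ltr_pdivlMr // mulrC.
    by rewrite powE.
  by rewrite hs ltxx.
have [|h hE h0] := @max_entropy_fin R _ A hA [set: state A]%SET.
  by move=> q _; rewrite inE.
rewrite hE -EFinM mulrC.
apply: has_box_dim_of_bounds => // t ht.
  exact: (covering_recognized_upper hk hd hE h0).
exact: (covering_recognized_lower hk hA hE).
Qed.
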